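(* Let $A:\mathbb R^d\to\mathbb R^d$, $V:\mathbb R^d\to\mathbb R$ be time-independent smooth potentials such that all partial derivatives of order $\ge2$ of $V+\frac12|A|^2$ are bounded and all partial derivatives of order $\ge1$ of $A$ are bounded. Consider a splitting integrator for $\mathbf h=\mathbf h_{\mathrm{kin}}+\mathbf h_{\mathrm{pot}}+\mathbf h_{\mathrm{mag}}$, with $\mathbf h_{\mathrm{kin}}=\frac12\mathbf p^\top\mathbf p$, $\mathbf h_{\mathrm{pot}}=\mathbf V(\mathbf q)$, $\mathbf h_{\mathrm{mag}}=-\mathbf A(\mathbf q)^\top\mathbf p$, built from a splitting scheme of order $\nu$ in which the sub-flows of $\mathbf h_{\mathrm{kin}}$ and $\mathbf h_{\mathrm{pot}}$ are exact and the sub-flow of $\mathbf h_{\mathrm{mag}}$ is replaced by the partitioned Runge--Kutta method with tableaus $(L,b)$ (for $\mathbf q$) and $(\hat L,b)$ (for $\mathbf p$), where $(L,b)$ is an explicit $s$-stage Runge--Kutta method of order $\nu$ with all $b_i\ne0$ and $\hat L=\mathbf 1_sb^\top-\mathrm{diag}(b)^{-1}L^\top\mathrm{diag}(b)$ (for step sizes for which the method is well-defined). Then the method conserves the symplecticity condition $$Y^\top\Omega_dY=\Omega_d,\qquad Y=\begin{pmatrix}\mathrm{Re}\,Q&\mathrm{Im}\,Q\\ \mathrm{Re}\,P&\mathrm{Im}\,P\end{pmatrix},$$ for the wave packet's width matrix. If the potentials $A$ and $V$ are symmetric with respect to translation, then it also conserves the linear momentum $\sum_{j=1}^dp_j$;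 if the potentials are symmetric with respect to rotation, then it also conserves the semiclassical angular momentum $$L_\varepsilon=pq^\top-qp^\top+\tfrac\varepsilon2\,\mathrm{Re}(PQ^*-QP^* ).$$
   Context: Let $d\in\mathbb N$, $\varepsilon>0$, $D=d+2d^2$, $\Omega_d=\begin{pmatrix}0&\mathrm{Id}_d\\-\mathrm{Id}_d&0\end{pmatrix}$. Canonical coordinates: for $q,p\in\mathbb R^d$, $Q,P\in\mathbb C^{d\times d}$, $\mathbf q=(q,\sqrt{\varepsilon/2}\,\mathrm{vec}(\mathrm{Re}\,Q),\sqrt{\varepsilon/2}\,\mathrm{vec}(\mathrm{Im}\,Q))\in\mathbb R^D$, $\mathbf p=(p,\sqrt{\varepsilon/2}\,\mathrm{vec}(\mathrm{Re}\,P),\sqrt{\varepsilon/2}\,\mathrm{vec}(\mathrm{Im}\,P))\in\mathbb R^D$; $\mathrm{vec}$ stacks columns. With $X_1=\sqrt{\varepsilon/2}\,\mathrm{Re}\,Q$, $X_2=\sqrt{\varepsilon/2}\,\mathrm{Im}\,Q$ and $f$ a function on $\mathbb R^d$ set $$\langle f\rangle(\mathbf q)=(2\pi)^{-d}\int_{\mathbb R^{2d}}f(q+X_1\zeta_1+X_2\zeta_2)\,e^{-\frac12(|\zeta_1|^2+|\zeta_2|^2)}\,d\zeta_1d\zeta_2 .$$ Averaged potentials: $\mathbf A(\mathbf q)=\big(\langle A\rangle,\mathrm{vec}(\langle J_A\rangle X_1),\mathrm{vec}(\langle J_A\rangle X_2)\big)$ with $J_A$ the Jacobi matrix of $A$,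 and $\mathbf V(\mathbf q)=\frac12\langle|A|^2\rangle+\langle V\rangle$. $J_{\mathbf A}$ is the Jacobi matrix of $\mathbf A$. Sub-steps: kinetic $\dot{\mathbf q}=\mathbf p,\dot{\mathbf p}=0$ and potential $\dot{\mathbf q}=0,\dot{\mathbf p}=-\nabla_{\mathbf q}\mathbf V(\mathbf q)$ are solved exactly; the magnetic equations $\dot{\mathbf q}=-\mathbf A(\mathbf q)$, $\dot{\mathbf p}=J_{\mathbf A}(\mathbf q)^\top\mathbf p$ are discretized with step $\tau$ by $$\mathbf q_{n+1}=\mathbf q_n+\tau\sum_{i}b_i\mathbf k^{(i)},\quad \mathbf p_{n+1}=\mathbf p_n+\tau\sum_{i}b_i\boldsymbol\ell^{(i)},$$ $$\mathbf k^{(i)}=-\mathbf A\Big(\mathbf q_n+\tau\sum_{j<i}l_{ij}\mathbf k^{(j)}\Big),\quad \boldsymbol\ell^{(i)}=M_n^{(i)}\Big(\mathbf p_n+\tau\sum_{j=1}^s\hat l_{ij}\boldsymbol\ell^{(j)}\Big),\quad M_n^{(i)}=J_{\mathbf A}\Big(\mathbf q_n+\tau\sum_{j<i}l_{ij}\mathbf k^{(j)}\Big)^\top,$$ with $L=(l_{ij})$, $\hat L=(\hat l_{ij})$, $\mathbf 1_s$ the vector of ones. A splitting scheme of order $\nu$ is a fixed composition of the three sub-flows with step sizes that are fixed multiples of $\tau$, having local error $O(\tau^{\nu+1})$ when exact sub-flows are used. Symmetries: translation symmetry means $A(x+c\mathbf 1)=A(x)$ and $V(x+c\mathbf 1)=V(x)$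 for all $x\in\mathbb R^d$, $c\in\mathbb R$, with $\mathbf 1=(1,\dots,1)^\top\in\mathbb R^d$; rotation symmetry means $A(Rx)=RA(x)$ and $V(Rx)=V(x)$ for all $x\in\mathbb R^d$, $R\in SO(d)$. *)

(* Defs.v *)
From HB Require Import structures.
From mathcomp Require Import all_boot all_order all_algebra.
From mathcomp Require Import complex.
From mathcomp Require Import all_classical all_reals all_analysis.

Set Implicit Arguments.
Unset Strict Implicit.
Unset Printing Implicit Defensive.

Import Order.TTheory GRing.Theory Num.Theory.
Import numFieldNormedType.Exports.

Local Open Scope classical_set_scope.
Local Open Scope ring_scope.

(* The library has the product sigma-algebra on n-tuples but no measure on
   it: Lebesgue measure on R^(n+1) is defined as the image of the product of
   Lebesgue measures on R and R^n under (x, t) |-> x :: t. *)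
Notation Rtuple R n := (n.-tuple (measurableTypeR R)).

Section LebesgueRn.
Variable R : realType.

Definition tcons n (z : measurableTypeR R * Rtuple R n) : Rtuple R n.+1 :=
  [the n.+1.-tuple _ of z.1 :: z.2].

Lemma measurable_tcons n : measurable_fun [set: _] (@tcons n).
Proof. by apply: measurable_cons; [exact: measurable_fst|exact: measurable_snd]. Qed.

Definition leb_cons n (m : {sigma_finite_measure set (Rtuple R n) -> \bar R}) :=
  pushforward (@lebesgue_measure R \x m)%E (@tcons n).

Section leb_cons.
Variables (n : nat) (m : {sigma_finite_measure set (Rtuple R n) -> \bar R}).

HB.instance Definition _ := Measure.copy (leb_cons m)
  (measure_function_pushforward__canonical__measure_function_Measure
     (@lebesgue_measure R \x m)%E (@measurable_tcons n)).

Lemma sigma_finite_leb_cons : sigma_finite setT (leb_cons m).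
Proof.
have /sigma_finiteP[F [TF ndF Foo]] := sigma_finiteT (@lebesgue_measure R).
have /sigma_finiteP[G [TG ndG Goo]] := sigma_finiteT m.
have mh : measurable_fun setT (fun t : Rtuple R n.+1 => thead t).
  exact: measurable_tnth.
have mb : measurable_fun setT (fun t : Rtuple R n.+1 => [tuple of behead t]).
  exact: measurable_behead.
exists (fun k => ((fun t : Rtuple R n.+1 => thead t) @^-1` F k) `&`
                 ((fun t : Rtuple R n.+1 => [tuple of behead t]) @^-1` G k)).
  rewrite predeqE => t; split=> // _.
  have : [set: measurableTypeR R] (thead t) by [].
  have : [set: Rtuple R n] [tuple of behead t] by [].
  rewrite TF TG => -[k _ Gk] [j _ Fj]; exists (maxn j k) => //; split.
    by have /subsetPset := ndF _ _ (leq_maxl j k); apply.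
  by have /subsetPset := ndG _ _ (leq_maxr j k); apply.
move=> k; have [mF Fk] := Foo k; have [mG Gk] := Goo k; split.
  apply: measurableI.
    by rewrite -[X in measurable X]setTI; exact: mh.
  by rewrite -[X in measurable X]setTI; exact: mb.
rewrite /leb_cons /pushforward [X in (_ X < _)%E](_ : _ = F k `*` G k).
  by rewrite product_measure1E// lte_mul_pinfty// ge0_fin_numE.
apply/seteqP; split => -[x t] /=.
  by rewrite /tcons /thead tnth0/=; case=> ? h; split => //; move: h;
     congr (G k _); apply/val_inj.
by rewrite /tcons /thead tnth0/=; case=> ? h; split => //; move: h;
   congr (G k _); apply/val_inj.
Qed.

HB.instance Definition _ :=
  Measure_isSigmaFinite.Build _ _ _ (leb_cons m) sigma_finite_leb_cons.

End leb_cons.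

Fixpoint lebesgue_Rn n : {sigma_finite_measure set (Rtuple R n) -> \bar R} :=
  match n with
  | 0 => \d_([tuple] : Rtuple R 0)
  | n'.+1 => leb_cons (lebesgue_Rn n')
  end.

End LebesgueRn.

Section Calculus.
Variable R : realType.
Implicit Types m n : nat.

Definition dot n (u v : 'cV[R]_n) : R := (u^T *m v) 0 0.

Definition sqnorm n (u : 'cV[R]_n) : R := dot u u.

Definition component n m (F : 'cV[R]_n -> 'cV[R]_m) (i : 'I_m) (x : 'cV[R]_n) : R :=
  F x i 0.

Definition pderiv n (i : 'I_n) (f : 'cV[R]_n -> R) (x : 'cV[R]_n) : R :=
  'D_(delta_mx i 0) f x.

Definition pderivs n (s : seq 'I_n) (f : 'cV[R]_n -> R) : 'cV[R]_n -> R :=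
  foldr (@pderiv n) f s.

Definition smooth n (f : 'cV[R]_n -> R) : Prop :=
  forall (s : seq 'I_n) (x : 'cV[R]_n), differentiable (pderivs s f) x.

Definition bounded_pderivs_from k n (f : 'cV[R]_n -> R) : Prop :=
  forall s : seq 'I_n, (k <= size s)%N ->
    exists C : R, forall x, `|pderivs s f x| <= C.

Definition grad n (f : 'cV[R]_n -> R) (x : 'cV[R]_n) : 'cV[R]_n :=
  \col_i pderiv i f x.

Definition jacobi n m (F : 'cV[R]_n -> 'cV[R]_m) (x : 'cV[R]_n) : 'M[R]_(m, n) :=
  \matrix_(i, j) pderiv j (component F i) x.

Definition integral_curve (E : normedModType R) (F : E -> E) (x : E)
    (c : R -> E) : Prop :=
  c 0 = x /\ forall t : R, is_derive t (1 : R) c (F (c t)).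

Definition exact_step (E : normedModType R) (F : E -> E) (t : R) (x y : E) : Prop :=
  exists2 c : R -> E, integral_curve F x c & c t = y.

End Calculus.

Section RungeKutta.
Variable R : realType.
Implicit Types s n : nat.

Definition explicit_tableau s (L : 'M[R]_s) : Prop :=
  forall i j : 'I_s, (i <= j)%N -> L i j = 0.

Definition stage_point s n (L : 'M[R]_s) (tau : R) (y : 'cV[R]_n)
    (k : 'I_s -> 'cV[R]_n) (i : 'I_s) : 'cV[R]_n :=
  y + tau *: \sum_(j < s | (j < i)%N) L i j *: k j.

Definition rk_stages s n (L : 'M[R]_s) (F : 'cV[R]_n -> 'cV[R]_n) (tau : R)
    (y : 'cV[R]_n) (k : 'I_s -> 'cV[R]_n) : Prop :=
  forall i, k i = F (stage_point L tau y k i).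

Definition rk_update s n (b : 'cV[R]_s) (tau : R) (y : 'cV[R]_n)
    (k : 'I_s -> 'cV[R]_n) : 'cV[R]_n :=
  y + tau *: \sum_i b i 0 *: k i.

(* Order of an explicit method: the local error is O(tau^(nu+1)) for every
   smooth autonomous equation y' = F(y), in every dimension. *)
Definition rk_order s (L : 'M[R]_s) (b : 'cV[R]_s) (nu : nat) : Prop :=
  forall (n : nat) (F : 'cV[R]_n -> 'cV[R]_n),
    (forall i, smooth (component F i)) ->
  forall y : R -> 'cV[R]_n,
    (\forall t \near (0 : R), is_derive t (1 : R) y (F (y t))) ->
  forall k : R -> 'I_s -> 'cV[R]_n,
    (forall tau, rk_stages L F tau (y 0) (k tau)) ->
  (fun tau : R => rk_update b tau (y 0) (k tau) - y tau)
    =O_ (0 : R) (fun tau : R => tau ^+ nu.+1).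

Definition conjugate_tableau s (L : 'M[R]_s) (b : 'cV[R]_s) : 'M[R]_s :=
  (const_mx 1 : 'cV[R]_s) *m b^T
  - invmx (diag_mx b^T) *m L^T *m diag_mx b^T.

End RungeKutta.

(* D = d + 2 d^2, split into the blocks q, vec X1, vec X2. *)
Notation bigdim d := (d + (d * d + d * d))%N.
Notation phase R d := ('cV[R]_(bigdim d) * 'cV[R]_(bigdim d))%type.

Section WavePackets.
Variables (R : realType) (d : nat).
Local Open Scope complex_scope.

Record packet := Packet {
  pos : 'cV[R]_d;
  mom : 'cV[R]_d;
  widthQ : 'M[R[i]]_d;
  widthP : 'M[R[i]]_d }.

Definition reM (M : 'M[R[i]]_d) : 'M[R]_d := map_mx (@complex.Re R) M.
Definition imM (M : 'M[R[i]]_d) : 'M[R]_d := map_mx (@complex.Im R) M.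
Definition adjM (M : 'M[R[i]]_d) : 'M[R[i]]_d := (map_mx (@conjc R) M)^T.

(* mxvec lists a matrix row by row, hence the transpositions. *)
Definition vec (X : 'M[R]_d) : 'cV[R]_(d * d) := (mxvec X^T)^T.
Definition unvec (v : 'cV[R]_(d * d)) : 'M[R]_d := (vec_mx v^T)^T.

Definition coords (eps : R) (w : packet) : phase R d :=
  let a := Num.sqrt (eps / 2) in
  (col_mx (pos w) (col_mx (a *: vec (reM (widthQ w))) (a *: vec (imM (widthQ w)))),
   col_mx (mom w) (col_mx (a *: vec (reM (widthP w))) (a *: vec (imM (widthP w))))).

Definition qpart (x : 'cV[R]_(bigdim d)) : 'cV[R]_d := usubmx x.
Definition X1part (x : 'cV[R]_(bigdim d)) : 'M[R]_d := unvec (usubmx (dsubmx x)).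
Definition X2part (x : 'cV[R]_(bigdim d)) : 'M[R]_d := unvec (dsubmx (dsubmx x)).

Definition Omega : 'M[R]_(d + d) := block_mx 0 1%:M (- 1%:M) 0.

Definition widthY (w : packet) : 'M[R]_(d + d) :=
  block_mx (reM (widthQ w)) (imM (widthQ w)) (reM (widthP w)) (imM (widthP w)).

Definition symplecticity (w : packet) : Prop :=
  (widthY w)^T *m Omega *m widthY w = Omega.

Definition linear_momentum (w : packet) : R := \sum_j mom w j 0.

Definition angular_momentum (eps : R) (w : packet) : 'M[R]_d :=
  mom w *m (pos w)^T - pos w *m (mom w)^T
  + (eps / 2) *: reM (widthP w *m adjM (widthQ w) - widthQ w *m adjM (widthP w)).

End WavePackets.

Section AveragedSystem.
Variables (R : realType) (d : nat).
Variables (A : 'cV[R]_d -> 'cV[R]_d) (V : 'cV[R]_d -> R).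
Implicit Types (x : 'cV[R]_(bigdim d)) (z : phase R d).

Definition zeta1 (t : Rtuple R (d + d)) : 'cV[R]_d := \col_i tnth t (lshift d i).
Definition zeta2 (t : Rtuple R (d + d)) : 'cV[R]_d := \col_i tnth t (rshift d i).

Definition average (f : 'cV[R]_d -> R) x : R :=
  (2 * pi) ^- d *
  \int[@lebesgue_Rn R (d + d)]_t
    (f (qpart x + X1part x *m zeta1 t + X2part x *m zeta2 t) *
     expR (- (1 / 2) * (sqnorm (zeta1 t) + sqnorm (zeta2 t)))).

Definition average_A x : 'cV[R]_d := \col_i average (component A i) x.
Definition average_JA x : 'M[R]_d :=
  \matrix_(i, j) average (fun y => jacobi A y i j) x.

Definition bigA x : 'cV[R]_(bigdim d) :=
  col_mx (average_A x)
    (col_mx (vec (average_JA x *m X1part x)) (vec (average_JA x *m X2part x))).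

Definition bigV x : R :=
  1 / 2 * average (fun y => sqnorm (A y)) x + average V x.

Inductive subsystem := Kin | Pot | Mag.

Definition sub_hamiltonian (k : subsystem) z : R :=
  match k with
  | Kin => 1 / 2 * dot z.2 z.2
  | Pot => bigV z.1
  | Mag => - dot (bigA z.1) z.2
  end.

Definition full_hamiltonian z : R :=
  sub_hamiltonian Kin z + sub_hamiltonian Pot z + sub_hamiltonian Mag z.

Definition hamiltonian_field (h : phase R d -> R) z : phase R d :=
  (grad (fun p => h (z.1, p)) z.2, - grad (fun q => h (q, z.2)) z.1).

Definition exact_substep (k : subsystem) (tau : R) : phase R d -> phase R d -> Prop :=
  exact_step (hamiltonian_field (sub_hamiltonian k)) tau.

Section Magnetic.
Variables (s : nat) (L Lhat : 'M[R]_s) (b : 'cV[R]_s).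

Definition momentum_stages (tau : R) z (k l : 'I_s -> 'cV[R]_(bigdim d)) : Prop :=
  forall i, l i = (jacobi bigA (stage_point L tau z.1 k i))^T *m
                  (z.2 + tau *: \sum_j Lhat i j *: l j).

(* The stages l are given by a linear system, which can be singular for some
   step sizes: the step is defined only if this system has a unique solution. *)
Definition magnetic_prk (tau : R) z z' : Prop :=
  exists k l : 'I_s -> 'cV[R]_(bigdim d),
    [/\ rk_stages L (fun x => - bigA x) tau z.1 k,
        momentum_stages tau z k l,
        forall l', momentum_stages tau z k l' -> l' = l &
        z' = (rk_update b tau z.1 k, rk_update b tau z.2 l)].

Definition numeric_substep (k : subsystem) (tau : R) : phase R d -> phase R d -> Prop :=
  match k with
  | Mag => magnetic_prk tau
  | _ => exact_substep k tau
  end.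

End Magnetic.

(* A scheme lists its substeps (k, c) in order of application: subsystem k is
   advanced by c * tau. *)
Fixpoint compose_substeps (step : subsystem -> R -> phase R d -> phase R d -> Prop)
    (scheme : seq (subsystem * R)) (tau : R) z z' : Prop :=
  match scheme with
  | [::] => z' = z
  | (k, c) :: rest =>
      exists2 y, step k (c * tau) z y & compose_substeps step rest tau y z'
  end.

Definition splitting_order (scheme : seq (subsystem * R)) (nu : nat) : Prop :=
  forall (z : phase R d) (split flow : R -> phase R d),
    (forall tau, compose_substeps exact_substep scheme tau z (split tau)) ->
    integral_curve (hamiltonian_field full_hamiltonian) z flow ->
  (fun tau : R => split tau - flow tau) =O_ (0 : R) (fun tau : R => tau ^+ nu.+1).

Definition integrator_step (eps : R) s (L : 'M[R]_s) (b : 'cV[R]_s)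
    (scheme : seq (subsystem * R)) (tau : R) (w w' : packet R d) : Prop :=
  compose_substeps (numeric_substep L (conjugate_tableau L b) b) scheme tau
    (coords eps w) (coords eps w').

Definition translation_symmetric : Prop :=
  forall (x : 'cV[R]_d) (c : R),
    A (x + const_mx c) = A x /\ V (x + const_mx c) = V x.

Definition rotation_symmetric : Prop :=
  forall (x : 'cV[R]_d) (U : 'M[R]_d), U^T *m U = 1%:M -> \det U = 1 ->
    A (U *m x) = U *m A x /\ V (U *m x) = V x.

End AveragedSystem.

(* Main.v *)
Require Import Defs.
From HB Require Import structures.
From mathcomp Require Import all_boot all_order all_algebra.
From mathcomp Require Import complex.
From mathcomp Require Import all_classical all_reals all_analysis.
From mathcomp Require Import measurable_realfun ring lra.

Set Implicit Arguments.
Unset Strict Implicit.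
Unset Printing Implicit Defensive.

Import Order.TTheory GRing.Theory Num.Theory.
Import numFieldNormedType.Exports.

Local Open Scope classical_set_scope.
Local Open Scope ring_scope.

(** All three conserved quantities are momentum maps, so the theorem is a
    discrete Noether theorem.  Let x |-> M x + u be an affine vector field on
    configuration space with M skew-symmetric, and put
      I(q, p) = (M q + u) . p.
    Each substep preserves I for a reason of its own
    (compose_substeps_conserves):
    - along the kinetic flow dI/dt = (M p) . p = 0;
    - along the potential flow dI/dt = - (M q + u) . grad V(q), which vanishes
      when the averaged potential V is invariant under the field;
    - for the magnetic equations the derivative vanishes at every stage when
      the averaged vector potential satisfies J_A(x) (M x + u) = M A(x), and the
      conjugacy b_i \hat l_ij + b_j l_ji = b_i b_j of the two tableaus makes the
      quadratic terms in the step size cancel (partitioned_rk_conserves).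

    A configuration (q, X1, X2) is read as a vector q with a d x 2d matrix
    Z = (X1 X2), and a momentum as p with W.  Three families of fields are used.
    Right multiplication Z |-> Z K with K skew of size 2d has momentum map
    Z^T W - W^T Z, which is eps/2 times Y^T Omega Y.  Left multiplication
    (q, Z) |-> (K q, K Z) with K skew of size d has momentum map
    p q^T - q p^T + W Z^T - Z W^T, the semiclassical angular momentum.  The
    constant field that translates q along (1, ..., 1) has momentum map
    sum_j p_j.

    The invariance hypotheses come from finite symmetries of the averages, which
    are Gaussian integrals of f(q + Z zeta).  Right multiplication of Z by an
    orthogonal matrix is absorbed by rotating the Gaussian variable zeta, for
    every A and V (average_right); left multiplication and translations act on
    the argument of f, and are handled by the symmetry of A and V.  For zeta the
    rotation invariance of Lebesgue measure is needed for rotations in a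
    coordinate plane only: such a rotation is a product of three transvections,
    and transvections preserve volume by Fubini and translation invariance on
    the line (preserves_volume_rotation).

    Passing from finite symmetries to the identities for grad V and J_A needs
    the averages to be differentiable.  The potentials and their derivatives
    have polynomial growth, so a second order Taylor estimate can be integrated
    against the Gaussian weight, and the average is Frechet differentiable
    without any interchange of limit and integral (differentiable_average). *)

(** * Rotations in a coordinate plane *)

Section PlaneRotations.
Variable R : realType.

Definition plane_gen n (i j : 'I_n) : 'M[R]_n := delta_mx i j - delta_mx j i.

Lemma plane_genT n (i j : 'I_n) : (plane_gen i j)^T = - plane_gen i j.
Proof. by rewrite /plane_gen linearB /= !trmx_delta opprB. Qed.

Lemma plane_gen_sqr n (i j : 'I_n) : i != j ->
  plane_gen i j *m plane_gen i j = - (delta_mx i i + delta_mx j j).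
Proof.
move=> ij; rewrite /plane_gen mulmxBl !mulmxBr !mul_delta_mx_cond !eqxx.
by rewrite (negPf ij) eq_sym (negPf ij) !mulr0n !mulr1n sub0r subr0 opprD.
Qed.

Lemma plane_gen_cube n (i j : 'I_n) : i != j ->
  plane_gen i j *m plane_gen i j *m plane_gen i j = - plane_gen i j.
Proof.
move=> ij; rewrite plane_gen_sqr// mulNmx; congr (- _).
rewrite /plane_gen mulmxBr !mulmxDl !mul_delta_mx_cond !eqxx.
by rewrite (negPf ij) eq_sym (negPf ij) !mulr0n !mulr1n addr0 add0r.
Qed.

(** The circle is parametrized rationally by u, the tangent of half the angle:
    the sine is 2 u / (1 + u^2), and one minus the cosine is u times the sine.
    The square of a plane generator is minus a projection, so [rotation K u] is
    the exponential of the angle times K.  This parameter makes the factors of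
    [rotation_transvections] polynomial in u and the sine. *)
Definition circle_sin (u : R) : R := 2 * u / (1 + u ^+ 2).

Lemma circle_sinE u : circle_sin u * (1 + u ^+ 2) = 2 * u.
Proof. by rewrite /circle_sin divfK// gt_eqF// ltr_wpDr// sqr_ge0. Qed.

Definition rotation n (K : 'M[R]_n) (u : R) : 'M[R]_n :=
  1%:M + circle_sin u *: K + (u * circle_sin u) *: (K *m K).

Lemma rotation_orthogonal n (K : 'M[R]_n) u : K^T = - K -> K *m K *m K = - K ->
  (rotation K u)^T *m rotation K u = 1%:M.
Proof.
move=> KT K3; rewrite /rotation !linearD /= trmx1 !linearZ /= trmx_mul KT mulmxN mulNmx opprK.
set s := circle_sin u; have sE : s * (1 + u ^+ 2) = 2 * u by exact: circle_sinE.
have K3' : K *m (K *m K) = - K by rewrite mulmxA.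
have K4 : K *m K *m (K *m K) = - (K *m K) by rewrite mulmxA K3 mulNmx.
rewrite !(mulmxDl, mulmxDr) -!(scalemxAl, scalemxAr) !(mul1mx, mulmx1).
rewrite !mulNmx K3 K3' K4; move: (K *m K) => K2.
apply/matrixP => p q; rewrite !mxE.
move: (K p q) (K2 p q) (_%:R) => x y z.
transitivity (z + s * (2 * u - s * (1 + u ^+ 2)) * y); first ring.
by rewrite sE; ring.
Qed.

Lemma plane_rotation_orthogonal n (i j : 'I_n) u : i != j ->
  (rotation (plane_gen i j) u)^T *m rotation (plane_gen i j) u = 1%:M.
Proof. by move=> ij; rewrite rotation_orthogonal ?plane_genT ?plane_gen_cube. Qed.

Lemma rotation_transvections n (i j : 'I_n) u : i != j ->
  rotation (plane_gen i j) u =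
  (1%:M + u *: delta_mx i j) *m (1%:M + (- circle_sin u) *: delta_mx j i)
    *m (1%:M + u *: delta_mx i j).
Proof.
move=> ij; rewrite /rotation plane_gen_sqr// /plane_gen.
have sE := circle_sinE u; set s := circle_sin u in sE *.
rewrite !(mulmxDl, mulmxDr, mul1mx, mulmx1) -!(scalemxAl, scalemxAr).
rewrite !mul_delta_mx mul_delta_mx_0 1?eq_sym// !scaler0 add0r.
apply/matrixP => p q; rewrite !mxE.
(* The entries of the identity and of the four matrix units. *)
move: (_%:R) (_%:R) (_%:R) (_%:R) (_%:R) => e00 ejj eii eji eij.
transitivity (e00 + (2 * u - s * u ^+ 2) * eij - s * eji - u * s * (eii + ejj)).
  have -> : 2 * u - s * u ^+ 2 = s by rewrite -sE; ring.
  ring.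
by ring.
Qed.

Lemma det_transvection n (i j : 'I_n) (a : R) : i != j ->
  \det (1%:M + a *: delta_mx i j) = 1.
Proof.
wlog ij : i j / (j < i)%N => [H nij|nij].
  have [ji|ij|/val_inj eij] := ltngtP i j; [|exact: H|by rewrite eij eqxx in nij].
  rewrite -det_tr linearD linearZ /= trmx1 trmx_delta; apply: H => //.
  by rewrite eq_sym.
rewrite det_trig.
  rewrite big1 // => k _; rewrite !mxE eqxx; case: eqP => [->|_] /=.
    by rewrite (negPf nij) mulr0 addr0.
  by rewrite mulr0 addr0.
apply/is_trig_mxP => k l kl; rewrite !mxE -(inj_eq val_inj) (ltn_eqF kl) add0r.
case: eqP => [ki|]; last by rewrite mulr0.
case: eqP => [lj|]; last by rewrite mulr0.
by move: kl; rewrite ki lj ltnNge ltnW.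
Qed.

Lemma det_rotation n (i j : 'I_n) u : i != j -> \det (rotation (plane_gen i j) u) = 1.
Proof.
move=> ij; have ji : j != i by rewrite eq_sym.
by rewrite rotation_transvections// !det_mulmx !det_transvection// !mulr1.
Qed.

Lemma tr_plane_gen n (i j : 'I_n) (B : 'M[R]_n) :
  \tr ((plane_gen i j)^T *m B) = B i j - B j i.
Proof.
have trE (k l : 'I_n) : \tr (delta_mx k l *m B) = B l k.
  rewrite /mxtrace (bigD1 k)//= big1 => [|m /negPf mk].
    rewrite addr0 mxE (bigD1 l)//= big1 => [|m /negPf ml].
      by rewrite mxE !eqxx mul1r addr0.
    by rewrite mxE ml andbF mul0r.
  by rewrite mxE big1 // => l' _; rewrite mxE mk mul0r.
by rewrite /plane_gen linearB /= !trmx_delta mulmxBl linearB /= !trE.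
Qed.

End PlaneRotations.
Arguments plane_gen {R n} i j.

(** * Volume-preserving linear maps *)

Section LebesgueInvariance.
Variable R : realType.

Let translation (a : R) (x : measurableTypeR R) : measurableTypeR R := x + a.

Let measurable_translation (a : R) :
  measurable_fun [set: measurableTypeR R] (translation a).
Proof. exact: measurable_funD. Qed.

Lemma lebesgue_measure_translation (a : R) (B : set (measurableTypeR R)) :
  measurable B ->
  lebesgue_measure (translation a @^-1` B) = lebesgue_measure B.
Proof.
move=> mB; rewrite -[LHS]/(pushforward (@lebesgue_measure R) (translation a) B).
pose m := measure_function_pushforward__canonical__measure_function_Measure
  (@lebesgue_measure R) (@measurable_translation a).
apply: esym; apply: (@lebesgue_measure_unique _ m) => // _ [[u v] /= uv <-].
rewrite /pushforward /=.
have -> : translation a @^-1` [set` `]u, v]] =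
          [set` `]u - a, v - a]].
  by apply/seteqP; split => x /=; rewrite !in_itv/= ltrBlDr lerBrDr.
by rewrite !lebesgue_measure_itv /= !lte_fin ltrD2r -!EFinD; congr (if _ then _ else _);
  congr (_%:E); ring.
Qed.

(** Lets the sections of a set of tuples be taken at fixed tail, so that the
    first coordinate can be integrated innermost. *)
Lemma product_measure_fst (n : nat)
  (B : set (measurableTypeR R * Rtuple R n)) : measurable B ->
  (@lebesgue_measure R \x @lebesgue_Rn R n)%E B =
  (@lebesgue_measure R \x^ @lebesgue_Rn R n)%E B.
Proof.
apply: (@product_measure_unique _ _ _ _ _ _ _
  (@lebesgue_measure R \x^ @lebesgue_Rn R n)%E) => A C mA mC.
exact: product_measure2E.
Qed.

Lemma tnth_tcons0 n (z : measurableTypeR R * Rtuple R n) : tnth (tcons z) ord0 = z.1.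
Proof. exact: tnth0. Qed.

Lemma tnth_tconsS n (z : measurableTypeR R * Rtuple R n) j :
  tnth (tcons z) (lift ord0 j) = tnth z.2 j.
Proof. exact: tnthS. Qed.

(** Transvections are generalized to affine shears because the induction on
    the dimension freezes the first coordinate, which turns its contribution
    into a constant. *)
Definition shear n (i : 'I_n) (a : R) (c : 'I_n -> R) (t : Rtuple R n) : Rtuple R n :=
  [tuple tnth t k + (if k == i then a + \sum_(j < n) c j * tnth t j else 0) | k < n].

Lemma measurable_shear n i a c : measurable_fun setT (@shear n i a c).
Proof.
apply/measurable_fun_tnthP => k.
rewrite (_ : _ \o _ = fun t : Rtuple R n =>
  tnth t k + (if k == i then a + \sum_(j < n) c j * tnth t j else 0)); last first.
  by apply/funext => t /=; rewrite tnth_mktuple.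
apply: measurable_funD; first exact: measurable_tnth.
case: (k == i) => //; apply: measurable_funD => //; apply: measurable_sum => j.
by apply: measurable_funM => //; exact: measurable_tnth.
Qed.

(** If the moved coordinate is the first one, each line parallel to it is
    translated; otherwise each hyperplane of constant first coordinate is
    sheared in one dimension less. *)
Lemma lebesgue_Rn_shear n i a c (B : set (Rtuple R n)) : c i = 0 ->
  measurable B -> lebesgue_Rn R n (shear i a c @^-1` B) = lebesgue_Rn R n B.
Proof.
elim: n i a c B => [[]//|n IH] i a c B ci mB.
have mT : measurable (@tcons R n @^-1` B).
  by rewrite -[X in measurable X]setTI; exact: measurable_tcons.
have mS : measurable (@tcons R n @^-1` (shear i a c @^-1` B)).
  rewrite -[X in measurable X]setTI; apply: measurable_tcons => //.
  by rewrite -[X in measurable X]setTI; exact: measurable_shear.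
rewrite /= /leb_cons /pushforward.
have [i0|[i' ii']] : i = ord0 \/ exists i', i = lift ord0 i'.
  by case: (unliftP ord0 i) => [j ->|->]; [right; exists j|left].
- rewrite !product_measure_fst//; apply: eq_integral => y _ /=.
  rewrite -(@lebesgue_measure_translation (a + \sum_(j < n) c (lift ord0 j) * tnth y j)
     (ysection (tcons (n:=n) @^-1` B) y)); last exact: measurable_ysection.
  congr (lebesgue_measure _); apply/seteqP.
  suff E x : shear i a c (tcons (x, y)) =
     tcons (x + (a + \sum_(j < n) c (lift ord0 j) * tnth y j), y).
    by split=> x; rewrite !ysectionP/= /ysection /= !inE /= E.
  apply/eq_from_tnth => k; rewrite tnth_mktuple big_ord_recl -[in c ord0]i0 ci mul0r add0r.
  under eq_bigr do rewrite tnth_tconsS.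
  case: (unliftP ord0 k) => [j ->|->].
    by rewrite !tnth_tconsS /= i0 -(inj_eq val_inj)/= addr0.
  by rewrite !tnth_tcons0 i0 eqxx.
- apply: eq_integral => x _ /=.
  rewrite -(IH i' (a + c ord0 * x) (c \o lift ord0) (xsection (tcons (n:=n) @^-1` B) x));
    [|by rewrite /= -ii'|exact: measurable_xsection].
  congr (lebesgue_Rn _ _ _); apply/seteqP.
  suff E y : shear i a c (tcons (x, y)) =
     tcons (x, shear i' (a + c ord0 * x) (c \o lift ord0) y).
    by split=> y; rewrite /xsection /= !inE /= E.
  apply/eq_from_tnth => k; rewrite tnth_mktuple big_ord_recl tnth_tcons0.
  under eq_bigr do rewrite tnth_tconsS.
  case: (unliftP ord0 k) => [j ->|->].
    rewrite !tnth_tconsS tnth_mktuple ii' (inj_eq lift_inj) /=.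
    by case: (j == i'); rewrite ?addrA.
  by rewrite !tnth_tcons0 ii' -(inj_eq val_inj)/= addr0.
Qed.

Definition tvec n (t : Rtuple R n) : 'cV[R]_n := \col_i tnth t i.

Definition mx_act n (g : 'M[R]_n) (t : Rtuple R n) : Rtuple R n :=
  [tuple (g *m tvec t) i 0 | i < n].

Lemma tvec_mx_act n (g : 'M[R]_n) t : tvec (mx_act g t) = g *m tvec t.
Proof. by apply/matrixP => i j; rewrite !ord1 mxE tnth_mktuple. Qed.

Lemma measurable_tvec n (i : 'I_n) :
  measurable_fun [set: Rtuple R n] (fun t => tvec t i 0).
Proof.
under eq_fun do rewrite mxE.
exact: measurable_tnth.
Qed.

Lemma measurable_mx_act n (g : 'M[R]_n) : measurable_fun setT (mx_act g).
Proof.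
apply/measurable_fun_tnthP => k.
rewrite (_ : _ \o _ = fun t : Rtuple R n => \sum_j g k j * tvec t j 0).
  by apply: measurable_sum => j; apply: measurable_funM => //; exact: measurable_tvec.
by apply/funext => t /=; rewrite tnth_mktuple mxE.
Qed.

Definition preserves_volume n (g : 'M[R]_n) : Prop :=
  forall B, measurable B -> lebesgue_Rn R n (mx_act g @^-1` B) = lebesgue_Rn R n B.

Lemma preserves_volumeM n (g h : 'M[R]_n) :
  preserves_volume g -> preserves_volume h -> preserves_volume (g *m h).
Proof.
move=> pg ph B mB; rewrite -[RHS]pg// -[RHS]ph; last first.
  by rewrite -[X in measurable X]setTI; exact: measurable_mx_act.
suff E t : mx_act (g *m h) t = mx_act g (mx_act h t).
  by congr (lebesgue_Rn _ _ _); apply/seteqP; split=> t /=; rewrite E.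
by apply/eq_from_tnth => k; rewrite !tnth_mktuple tvec_mx_act mulmxA.
Qed.

Lemma preserves_volume_transvection n (i j : 'I_n) (a : R) : i != j ->
  preserves_volume (1%:M + a *: delta_mx i j).
Proof.
move=> ij B mB; pose c k := if k == j then a else 0.
rewrite -(@lebesgue_Rn_shear n i 0 c B)//; last by rewrite /c (negPf ij).
suff E t : mx_act (1%:M + a *: delta_mx i j) t = shear i 0 c t.
  by congr (lebesgue_Rn _ _ _); apply/seteqP; split=> t /=; rewrite E.
apply/eq_from_tnth => k; rewrite !tnth_mktuple mulmxDl mul1mx -scalemxAl !mxE.
congr (_ + _); rewrite (bigD1 j)//= big1 => [|l /negPf lj]; last first.
  by rewrite !mxE lj andbF mul0r.
rewrite !mxE eqxx andbT addr0 add0r; case: (k == i); rewrite ?mul0r ?mulr0//.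
rewrite mul1r (bigD1 j)//= big1 => [|l /negPf lj]; last by rewrite /c lj mul0r.
by rewrite /c eqxx addr0.
Qed.

Lemma preserves_volume_rotation n (i j : 'I_n) u : i != j ->
  preserves_volume (rotation (plane_gen i j) u).
Proof.
move=> ij; rewrite rotation_transvections//.
by apply: preserves_volumeM; first apply: preserves_volumeM;
  apply: preserves_volume_transvection; rewrite // eq_sym.
Qed.

Lemma Rintegral_mx_act n (g : 'M[R]_n) (h : Rtuple R n -> R) :
  preserves_volume g -> measurable_fun setT h ->
  (lebesgue_Rn R n).-integrable setT (EFin \o (h \o mx_act g)) ->
  \int[lebesgue_Rn R n]_t h (mx_act g t) = \int[lebesgue_Rn R n]_t h t.
Proof.
move=> pg mh hg; congr fine.
have mE : measurable_fun setT (EFin \o h) by exact/measurable_EFinP.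
have /(_ measurableT) := @integral_pushforward _ _ _ _ _ _ (measurable_mx_act g)
  (lebesgue_Rn R n) setT (EFin \o h) mE hg.
rewrite preimage_setT => <-.
apply: eq_measure_integral => [|mg B mB _]; first exact: measurable_mx_act.
exact: pg.
Qed.

End LebesgueInvariance.

(** * Gaussian moments *)

Section Gaussian.
Variable R : realType.

Definition gauss n (t : Rtuple R n) : R := expR (- (1 / 2) * sqnorm (tvec t)).

(** The product of the 1 + |t_i| dominates the norm of the vector t and, unlike
    a norm, turns its powers times the Gaussian into a product of functions of
    one variable. *)
Definition size_bound n (t : Rtuple R n) : R := \prod_(i < n) (1 + `|tnth t i|).

Lemma size_bound_ge n (t : Rtuple R n) :
  1 + \sum_(i < n) `|tnth t i| <= size_bound t.
Proof.
rewrite /size_bound; elim: n t => [|n IH] t; first by rewrite !big_ord0 addr0.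
rewrite (tuple_eta t) !big_ord_recl.
under eq_bigr do rewrite tnthS; under [in leRHS]eq_bigr do rewrite tnthS.
have := IH [tuple of behead t]; rewrite tnth0.
set S := \sum__ _; set P := \prod__ _; move: `|thead t| (normr_ge0 (thead t)) => a a0 SP.
have S0 : 0 <= S by apply: sumr_ge0.
nra.
Qed.

Lemma size_bound_ge1 n (t : Rtuple R n) : 1 <= size_bound t.
Proof. by apply: le_trans (size_bound_ge t); rewrite lerDl sumr_ge0. Qed.

Lemma sqnormE n (v : 'cV[R]_n) : sqnorm v = \sum_i v i 0 ^+ 2.
Proof. by rewrite /sqnorm /dot mxE; apply: eq_bigr => i _; rewrite mxE expr2. Qed.

Lemma gaussE n (t : Rtuple R n) : gauss t = \prod_(i < n) expR (- (1 / 2) * tnth t i ^+ 2).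
Proof.
rewrite /gauss sqnormE mulr_sumr expR_sum.
by apply: eq_bigr => i _; rewrite mxE.
Qed.

Lemma gauss_ge0 n (t : Rtuple R n) : 0 <= gauss t.
Proof. exact: expR_ge0. Qed.

Lemma measurable_gauss n : measurable_fun [set: Rtuple R n] (@gauss n).
Proof.
apply: (measurableT_comp (@measurable_expR R)); apply: measurable_funM => //.
under eq_fun do rewrite sqnormE.
by apply: measurable_sum => i; apply: measurable_funX; exact: measurable_tvec.
Qed.

Lemma measurable_prod_tnth n (h : R -> R) : measurable_fun setT h ->
  measurable_fun [set: Rtuple R n] (fun t => \prod_(i < n) h (tnth t i)).
Proof.
move=> mh; apply: measurable_prod => i _.
by apply: (measurableT_comp mh); exact: measurable_tnth.
Qed.

Lemma integral_prod_tnth_lty n (h : R -> R) : measurable_fun setT h ->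
  (forall x, 0 <= h x) -> (\int[lebesgue_measure]_x (h x)%:E < +oo)%E ->
  (\int[lebesgue_Rn R n]_t (\prod_(i < n) h (tnth t i))%:E < +oo)%E.
Proof.
move=> mh h0 hoo; elim: n => [|n IH].
  rewrite integral_dirac//=; first by rewrite big_ord0 diracT mul1e ltry.
  by apply/measurable_EFinP; exact: measurable_prod_tnth.
rewrite /= /leb_cons.
have p0 m (t : Rtuple R m) : (0 <= (\prod_(i < m) h (tnth t i))%:E)%E.
  by rewrite lee_fin prodr_ge0.
rewrite ge0_integral_pushforward//; first last.
- by move=> t _; exact: p0.
- by apply/measurable_EFinP; exact: measurable_prod_tnth.
- exact: measurable_tcons.
rewrite preimage_setT fubini_tonelli1//=; first last.
- by move=> z; exact: p0.
- apply/measurable_EFinP.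
  apply: (measurableT_comp (@measurable_prod_tnth n.+1 h mh)); exact: measurable_tcons.
rewrite /fubini_F /=.
have mp : measurable_fun [set: Rtuple R n]
    (fun t => (\prod_(i < n) h (tnth t i))%:E).
  by apply/measurable_EFinP; exact: measurable_prod_tnth.
have mh' : measurable_fun setT (EFin \o h) by exact/measurable_EFinP.
pose I := (\int[lebesgue_Rn R n]_t (\prod_(i < n) h (tnth t i))%:E)%E.
rewrite (eq_integral (fun x : measurableTypeR R => (h x)%:E * I)%E); last first.
  move=> x _; rewrite -ge0_integralZl//; last by rewrite lee_fin.
  apply: eq_integral => t _; rewrite big_ord_recl tnth_tcons0 -EFinM.
  by under eq_bigr do rewrite tnth_tconsS.
have I0 : (0 <= I)%E by apply: integral_ge0.
rewrite ge0_integralZr//; last by move=> x _; rewrite lee_fin.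
rewrite lte_mul_pinfty//; first by apply: integral_ge0 => x _; rewrite lee_fin.
by rewrite ge0_fin_numE//; apply: integral_ge0 => x _; rewrite lee_fin.
Qed.

Lemma measurable_gauss_moment (k : nat) :
  measurable_fun [set: measurableTypeR R]
    (fun x : R => (1 + `|x|) ^+ k * expR (- (1 / 2) * x ^+ 2)).
Proof.
apply: measurable_funM.
  apply: measurable_funX; apply: measurable_funD; first exact: measurable_cst.
  exact: normr_measurable.
apply: (measurableT_comp (@measurable_expR R)).
apply: measurable_funM; first exact: measurable_cst.
apply: measurable_funX; exact: measurable_id.
Qed.

(** Since k |x| <= k^2 + x^2 / 4, the integrand is at most a constant times a
    Gaussian of variance 2. *)
Lemma gauss_moment_1d (k : nat) :
  (\int[lebesgue_measure]_x (((1 + `|x|) ^+ k * expR (- (1 / 2) * x ^+ 2)) : R)%:E < +oo)%E.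
Proof.
pose s : R := Num.sqrt 2.
have s2 : s ^+ 2 = 2 by rewrite sqr_sqrtr.
have s0 : s != 0 by rewrite gt_eqF// sqrtr_gt0.
pose C : R := expR (k%:R ^+ 2) / normal_peak s.
have C0 : 0 <= C by rewrite divr_ge0 ?expR_ge0 ?normal_peak_ge0.
apply: (@le_lt_trans _ _ (\int[lebesgue_measure]_x (C%:E * (normal_pdf 0 s x)%:E))%E).
  apply: ge0_le_integral => //=.
  - by apply/measurable_EFinP; exact: measurable_gauss_moment.
  - apply/measurable_EFinP; apply: measurable_funM => //.
    exact: measurable_normal_pdf.
  move=> x _; rewrite -EFinM lee_fin normal_pdfE//= /C [leRHS]mulrA divfK; last first.
    by rewrite gt_eqF// normal_peak_gt0.
  rewrite /normal_fun s2 subr0.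
  apply: (@le_trans _ _ (expR `|x| ^+ k * expR (- (1 / 2) * x ^+ 2))).
    rewrite ler_wpM2r ?expR_ge0// lerXn2r ?nnegrE ?addr_ge0 ?expR_ge0//.
    exact: expR_ge1Dx.
  rewrite -expRM_natl -!expRD ler_expR -(real_normK (num_real x)).
  have : 0 <= (k%:R - `|x| / 2) ^+ 2 by exact: sqr_ge0.
  have -> : 2 *+ 2 = 4 :> R by rewrite -mulr_natr -natrM.
  by move: (k%:R) `|x| => a b; nra.
rewrite ge0_integralZl//=.
- by rewrite integral_normal_pdf mule1 ltry.
- by apply/measurable_EFinP; exact: measurable_normal_pdf.
- by move=> x _; rewrite lee_fin normal_pdf_ge0.
Qed.

Lemma integrable_size_gauss n (k : nat) :
  (lebesgue_Rn R n).-integrable setT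
    (EFin \o (fun t => size_bound t ^+ k * gauss t)).
Proof.
pose h (x : R) := (1 + `|x|) ^+ k * expR (- (1 / 2) * x ^+ 2).
have E (t : Rtuple R n) : size_bound t ^+ k * gauss t = \prod_(i < n) h (tnth t i).
  by rewrite gaussE -prodrXl -big_split.
have h0 x : 0 <= h x by rewrite mulr_ge0 ?exprn_ge0 ?expR_ge0// addr_ge0.
have mh : measurable_fun setT h by exact: measurable_gauss_moment.
apply/integrableP; split.
  apply/measurable_EFinP; rewrite (_ : (fun t => _) = fun t => \prod_(i < n) h (tnth t i)).
    exact: measurable_prod_tnth.
  by apply/funext => t; exact: E.
under eq_integral => t _.
  rewrite /= E ger0_norm ?prodr_ge0//.
  over.
by apply: integral_prod_tnth_lty => //; exact: gauss_moment_1d.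
Qed.

Lemma integrable_gaussM n (g : Rtuple R n -> R) (C : R) (k : nat) :
  measurable_fun setT g -> (forall t : Rtuple R n, `|g t| <= C * size_bound t ^+ k) ->
  (lebesgue_Rn R n).-integrable setT (EFin \o (fun t : Rtuple R n => g t * gauss t)).
Proof.
move=> mg gC.
apply: (@le_integrable _ _ _ _ _ measurableT _
  (EFin \o (fun t : Rtuple R n => C * (size_bound t ^+ k * gauss t)))).
- by apply/measurable_EFinP; apply: measurable_funM => //; exact: measurable_gauss.
- move=> t _; rewrite lee_fin /= normrM (ger0_norm (gauss_ge0 t)).
  rewrite (le_trans (ler_wpM2r (gauss_ge0 t) (gC t)))// -mulrA.
  exact: ler_norm.
- rewrite (_ : _ \o _ = fun t : Rtuple R n =>
    (C%:E * (EFin \o (fun t => (size_bound t ^+ k * gauss t)%R)) t)%E) //.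
  by apply: integrableZl => //; exact: integrable_size_gauss.
Qed.

Lemma Rintegral_sum n m (f : 'I_m -> Rtuple R n -> R) :
  (forall k, (lebesgue_Rn R n).-integrable setT (EFin \o f k)) ->
  (lebesgue_Rn R n).-integrable setT (EFin \o (fun t => \sum_(k < m) f k t)) /\
  \int[lebesgue_Rn R n]_t (\sum_(k < m) f k t) =
  \sum_(k < m) \int[lebesgue_Rn R n]_t f k t.
Proof.
elim: m f => [|m IH] f fi.
  under eq_fun do rewrite big_ord0; split; first exact: integrable0.
  by rewrite big_ord0 Rintegral_cst// mul0r.
have [i1 e1] := IH (fun k => f (widen_ord (leqnSn m) k)) (fun k => fi _).
under eq_fun do rewrite big_ord_recr /=; split.
  have := integrableD measurableT i1 (fi ord_max).
  exact: eq_integrable.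
by rewrite big_ord_recr /= -e1 RintegralD//; exact: fi.
Qed.

End Gaussian.

(** * Derivatives along curves *)

Section Curves.
Variable R : realType.

Lemma is_derive_continuous_linear (U W : normedModType R)
    (f : {linear U -> W}) (c : R -> U) t v :
  continuous f -> is_derive t (1 : R) c v -> is_derive t (1 : R) (f \o c) (f v).
Proof.
move=> cf dc.
have dc' : differentiable c t by apply/derivable1_diffP; exact: ex_derive.
have df x : differentiable f x by exact: linear_differentiable.
have dv : 'd c t 1 = v by rewrite -deriveE//; exact: derive_val.
apply: DeriveDef; first exact/diff_derivable/differentiable_comp.
rewrite deriveE; last exact: differentiable_comp.
by rewrite diff_comp//= dv diff_lin.
Qed.

Lemma is_derive_coord (W : normedModType R) m n (c : W -> 'M[R]_(m, n)) t w v i j :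
  is_derive t w c v -> is_derive t w (fun r => c r i j) (v i j).
Proof.
move=> dc; have dv : 'D_w c t = v by exact: derive_val.
have dct : derivable c t w by exact: ex_derive.
apply: DeriveDef; first exact: (proj1 (derivable_mxP c t w) dct i j).
by rewrite -dv derive_mx// mxE.
Qed.

Lemma is_derive_mx m n (c : R -> 'M[R]_(m, n)) t (v : 'M[R]_(m, n)) :
  (forall i j, is_derive t (1 : R) (fun r => c r i j) (v i j)) ->
  is_derive t (1 : R) c v.
Proof.
move=> dc; have dct : derivable c t 1.
  by apply: (proj2 (derivable_mxP c t 1)) => i j; exact: ex_derive.
apply: DeriveDef => //; rewrite derive_mx//.
by apply/matrixP => i j; rewrite mxE; exact: derive_val.
Qed.

Lemma derive_pderiv n (f : 'cV[R]_n -> R) (x v : 'cV[R]_n) :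
  differentiable f x -> 'D_v f x = \sum_i v i 0 * pderiv i f x.
Proof.
move=> df; rewrite deriveE// {1}[v]matrix_sum_delta.
under eq_bigr do rewrite big_ord1.
rewrite linear_sum /=; apply: eq_bigr => i _.
by rewrite linearZ /= /pderiv deriveE.
Qed.

Lemma is_derive_along n (f : 'cV[R]_n -> R) (c : R -> 'cV[R]_n) (t : R) v :
  differentiable f (c t) -> is_derive t (1 : R) c v ->
  is_derive t (1 : R) (f \o c) (\sum_i v i 0 * pderiv i f (c t)).
Proof.
move=> df dc.
have dc' : differentiable c t by apply/derivable1_diffP; exact: ex_derive.
have dfc : differentiable (f \o c) t by exact: differentiable_comp.
apply: DeriveDef; first exact: diff_derivable.
have dv : 'd c t 1 = v by rewrite -deriveE//; exact: derive_val.
by rewrite deriveE// diff_comp//= dv -deriveE// derive_pderiv.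
Qed.

Lemma chain_rule m n (F : 'cV[R]_n -> 'cV[R]_m) (c : R -> 'cV[R]_n) t v :
  (forall i, differentiable (component F i) (c t)) ->
  is_derive t (1 : R) c v -> is_derive t (1 : R) (F \o c) (jacobi F (c t) *m v).
Proof.
move=> dF dc; apply: is_derive_mx => i j; rewrite ord1.
apply: (is_derive_eq (is_derive_along (dF i) dc)).
by rewrite mxE; apply: eq_bigr => k _; rewrite !mxE mulrC.
Qed.

Lemma is_derive_unique (W : normedModType R) (f : R -> W) t u v :
  is_derive t (1 : R) f u -> is_derive t (1 : R) f v -> u = v.
Proof.
move=> du dv.
by rewrite -(@derive_val _ _ _ _ _ _ _ du) (@derive_val _ _ _ _ _ _ _ dv).
Qed.

Lemma is_derive_line n (x u : 'cV[R]_n) (t : R) :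
  is_derive t (1 : R) (fun r => x + r *: u) u.
Proof.
apply: is_derive_mx => i j.
rewrite (_ : (fun r => _) = (fun r => x i j + r * u i j)); last first.
  by apply/funext => r; rewrite !mxE.
have dc (a : R) : is_derive t (1 : R) (fun _ : R => a) 0 by exact: is_derive_cst.
apply: (is_derive_eq (is_deriveD (dc (x i j))
  (is_deriveM (is_derive_id t (1 : R)) (dc (u i j))))).
by rewrite /GRing.scale /= mulr0 !add0r mulr1.
Qed.

(** The linear functional that should approximate g is zero, which makes this
    the form in which a Taylor estimate yields differentiability: subtract the
    value and the candidate differential first. *)
Lemma differentiable_quadratic n (g : 'cV[R]_n -> R) (x : 'cV[R]_n) (C : R) :
  (forall h, `|h| <= 1 -> `|g (h + x)| <= C * `|h| ^+ 2) -> differentiable g x.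
Proof.
move=> gC.
have gx : g x = 0.
  have := gC 0; rewrite normr0 ler01 add0r expr0n mulr0 => /(_ isT).
  by rewrite normr_le0 => /eqP.
apply/diffP => /=.
apply: (@getPex _ (fun df : {linear 'cV[R]_n -> R} => continuous df /\
  forall y, g y = g (lim (nbhs x)) + df (y - lim (nbhs x))
                  +o_(y \near x) (y - lim (nbhs x)))).
exists (\0 : {linear 'cV[R]_n -> R}); split.
  exact: (@cst_continuous _ _ (0 : R)).
have E : g = (fun y => g (lim (nbhs x)) + (\0 : {linear 'cV[R]_n -> R}) (y - lim (nbhs x)))
   +o_ x (fun y => y - lim (nbhs x)).
  apply/eqaddoP; rewrite lim_id//.
  move=> _/posnumP[e].
  have nb : nbhs x (fun y => `|x - y| < Num.min 1 (e%:num / (`|C| + 1))).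
    apply/(@nbhs_ballP R); exists (Num.min 1 (e%:num / (`|C| + 1))).
      by rewrite /= lt_min ltr01 divr_gt0// ltr_wpDl.
    by move=> y; rewrite -ball_normE.
  near=> y.
  rewrite !fctE /= gx.
  rewrite addr0 subr0; pose h := y - x.
  have hd : `|h| < Num.min 1 (e%:num / (`|C| + 1)).
    rewrite distrC; near: y; exact: nb.
  move: hd; rewrite lt_min => /andP[h1]; rewrite ltr_pdivlMr ?ltr_wpDl// => hC.
  rewrite -(subrK x y) addrK -/h; apply: (le_trans (gC _ (ltW h1))).
  rewrite expr2 mulrA ler_wpM2r//; apply: le_trans (ltW hC).
  by rewrite mulrC ler_wpM2l// (le_trans (ler_norm _))// lerDl ler01.
by move=> y; rewrite {1}E.
Unshelve. all: by end_near. Qed.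

End Curves.

(** * Functions of polynomial growth *)

Section Growth.
Variable R : realType.

(** One natural number serves as constant and as exponent, so that bounds can
    be merged by taking a maximum or a sum. *)
Definition growth n (M : nat) (f : 'cV[R]_n -> R) : Prop :=
  forall x, `|f x| <= M%:R * (1 + `|x|) ^+ M.

Definition pgrowth n (f : 'cV[R]_n -> R) : Prop := exists M, growth M f.

Lemma coord_le_norm m n (A : 'M[R]_(m, n)) i j : `|A i j| <= `|A|.
Proof. by rewrite [leRHS]mx_normrE; exact: (le_bigmax _ _ (i, j)). Qed.

Lemma norm_le_coord m n (A : 'M[R]_(m, n)) (c : R) : 0 <= c ->
  (forall i j, `|A i j| <= c) -> `|A| <= c.
Proof. by move=> c0 Ac; rewrite [leLHS]mx_normrE bigmax_le. Qed.

Lemma le_monomial (M N : nat) (r s : R) : 1 <= r -> r <= s -> (M <= N)%N ->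
  M%:R * r ^+ M <= N%:R * s ^+ N.
Proof.
move=> r1 rs MN; have r0 : 0 <= r by rewrite (le_trans ler01).
rewrite ler_pM ?exprn_ge0 ?ler_nat//.
apply: (le_trans (ler_weXn2l r1 MN)); rewrite lerXn2r// nnegrE//.
exact: le_trans rs.
Qed.

Lemma growth_le n (M N : nat) (f : 'cV[R]_n -> R) : (M <= N)%N -> growth M f -> growth N f.
Proof.
by move=> MN fM x; apply: le_trans (fM x) _; rewrite le_monomial// lerDl.
Qed.

Lemma uniform_growth n m (f : 'I_m -> 'cV[R]_n -> R) :
  (forall i, pgrowth (f i)) -> exists M, forall i, growth M (f i).
Proof.
move=> /fin_all_exists[M fM]; exists (\max_i M i)%N => i.
by apply: growth_le (fM i); exact: leq_bigmax.
Qed.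

Lemma pgrowthD n (f g : 'cV[R]_n -> R) :
  pgrowth f -> pgrowth g -> pgrowth (fun x => f x + g x).
Proof.
move=> [M fM] [N gN]; exists (M + N)%N => x.
rewrite natrD mulrDl (le_trans (ler_normD _ _))// lerD//.
  apply: (le_trans (fM x)); rewrite ler_wpM2l// ler_weXn2l ?leq_addr//.
  by rewrite lerDl.
apply: (le_trans (gN x)); rewrite ler_wpM2l// ler_weXn2l ?leq_addl//.
by rewrite lerDl.
Qed.

Lemma pgrowthM n (f g : 'cV[R]_n -> R) :
  pgrowth f -> pgrowth g -> pgrowth (fun x => f x * g x).
Proof.
move=> [M fM] [N gN]; exists (M * N + (M + N))%N => x.
rewrite normrM (le_trans (ler_pM _ _ (fM x) (gN x)))//.
rewrite mulrACA -natrM -exprD ler_pM ?exprn_ge0 ?addr_ge0// ?ler_nat ?leq_addr//.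
by rewrite ler_weXn2l ?leq_addl// lerDl.
Qed.

Lemma pgrowth_bounded n (f : 'cV[R]_n -> R) (C : R) :
  (forall x, `|f x| <= C) -> pgrowth f.
Proof.
move=> fC; exists (Num.truncn C).+1 => x.
apply: (le_trans (fC x)); apply: (@le_trans _ _ (Num.truncn C).+1%:R).
  by rewrite ltW// truncnS_gt.
by rewrite ler_peMr// exprn_ege1// lerDl.
Qed.

Lemma pgrowth_cst n (a : R) : pgrowth (fun _ : 'cV[R]_n => a).
Proof. exact: (@pgrowth_bounded _ _ `|a|). Qed.

Lemma increment_mean n (f : 'cV[R]_n -> R) (x h : 'cV[R]_n) :
  (forall y, differentiable f y) ->
  exists2 c : R, 0 <= c <= 1 &
    f (x + h) - f x = \sum_i h i 0 * pderiv i f (x + c *: h).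
Proof.
move=> df; pose c (t : R) := x + t *: h.
have dc t : is_derive t (1 : R) c h by exact: is_derive_line.
have dfc t := is_derive_along (df (c t)) (dc t).
have [|a] := @MVT_segment R (f \o c) _ 0 1 ler01 (fun t _ => dfc t).
  apply: continuous_subspaceT => t.
  apply: differentiable_continuous; apply/derivable1_diffP.
  by have [] := dfc t.
rewrite in_itv /= => a01; rewrite subr0 mulr1 /c /= scale0r addr0 scale1r => E.
by exists a.
Qed.

Lemma increment_bound n (f : 'cV[R]_n -> R) (M : nat) (x h : 'cV[R]_n) :
  (forall y, differentiable f y) -> (forall i, growth M (pderiv i f)) ->
  `|f (x + h) - f x| <= n%:R * (`|h| * (M%:R * (1 + `|x| + `|h|) ^+ M)).
Proof.
move=> df fM; have [c /andP[c0 c1] ->] := increment_mean x h df.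
apply: (le_trans (ler_norm_sum _ _ _)).
apply: (@le_trans _ _ (\sum_(i < n) (`|h| * (M%:R * (1 + `|x| + `|h|) ^+ M)))).
  apply: ler_sum => i _; rewrite normrM ler_pM//; first exact: coord_le_norm.
  apply: (le_trans (fM i _)); rewrite ler_wpM2l// lerXn2r ?nnegrE ?addr_ge0//.
  rewrite -addrA lerD2l (le_trans (ler_normD _ _))// lerD2l.
  by rewrite normrZ ger0_norm// ler_piMl.
by rewrite sumr_const card_ord [leRHS]mulr_natl.
Qed.

Lemma pgrowth_primitive n (f : 'cV[R]_n -> R) :
  (forall y, differentiable f y) -> (forall i, pgrowth (pderiv i f)) -> pgrowth f.
Proof.
move=> df /uniform_growth[M fM].
have [N N0] : pgrowth (fun _ : 'cV[R]_n => f 0).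
  by apply: (@pgrowth_bounded _ _ `|f 0|) => x.
have : pgrowth (fun x => f 0 + (f x - f 0)).
  apply: pgrowthD; first by exists N.
  (* M.+1 because the increment bound carries a factor |x|. *)
  exists (n * M + M.+1)%N => x.
  have := increment_bound 0 x df fM; rewrite add0r normr0 addr0 => /le_trans; apply.
  rewrite (_ : n%:R * _ = (n * M)%:R * (`|x| * (1 + `|x|) ^+ M)); last first.
    by rewrite natrM; ring.
  apply: (@le_trans _ _ ((n * M)%:R * (1 + `|x|) ^+ M.+1)).
    by rewrite exprS ler_wpM2l// ler_wpM2r ?exprn_ge0 ?addr_ge0// lerDr.
  rewrite ler_pM ?exprn_ge0 ?addr_ge0// ?ler_nat ?leq_addr//.
  by rewrite ler_weXn2l ?leq_addl// lerDl.
by under eq_fun do rewrite addrC subrK.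
Qed.

(** The mean value theorem is applied to f, and then to each partial derivative
    of f, between the same two points. *)
Lemma taylor_bound n (f : 'cV[R]_n -> R) :
  (forall y, differentiable f y) ->
  (forall i y, differentiable (pderiv i f) y) ->
  (forall i j, pgrowth (pderiv j (pderiv i f))) ->
  exists M : nat, forall x h,
    `|f (x + h) - f x - \sum_i h i 0 * pderiv i f x|
      <= M%:R * (1 + `|x| + `|h|) ^+ M * `|h| ^+ 2.
Proof.
move=> df ddf /= gf.
have [M fM] : exists M, forall i j, growth M (pderiv j (pderiv i f)).
  have [|M fM] := @fin_all_exists _ _ (fun i M => forall j, growth M (pderiv j (pderiv i f))).
    by move=> i; apply: uniform_growth => j.
  exists (\max_i M i)%N => i j; apply: growth_le (fM i j); exact: leq_bigmax.
exists (n * n * M + M)%N => x h; have [c /andP[c0 c1] ->] := increment_mean x h df.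
rewrite -sumrB; apply: (le_trans (ler_norm_sum _ _ _)).
pose r : R := 1 + `|x| + `|h|.
have r1 : 1 <= r by rewrite /r -addrA lerDl addr_ge0.
apply: (@le_trans _ _ (\sum_(i < n) (`|h| * (n%:R * (`|h| * (M%:R * r ^+ M)))))).
  apply: ler_sum => i _; rewrite -mulrBr normrM ler_pM//; first exact: coord_le_norm.
  apply: (le_trans (increment_bound x _ (ddf i) (fM i))).
  have ch : `|c *: h| <= `|h| by rewrite normrZ ger0_norm// ler_piMl.
  rewrite ler_wpM2l// ler_pM ?mulr_ge0 ?exprn_ge0 ?addr_ge0// ler_wpM2l//.
  by rewrite lerXn2r ?nnegrE ?addr_ge0// /r lerD2l.
rewrite sumr_const card_ord -[leLHS]mulr_natl.
rewrite (_ : n%:R * _ = (n * n * M)%:R * r ^+ M * `|h| ^+ 2); last first.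
  by rewrite !natrM; ring.
rewrite ler_wpM2r ?sqr_ge0// ler_pM ?exprn_ge0 ?(le_trans ler01 r1)// ?ler_nat ?leq_addr//.
by rewrite ler_weXn2l// leq_addl.
Qed.

End Growth.

(** * Slowly increasing functions *)

Section Tame.
Variable R : realType.

(** Differentiability up to order m + 1, with all partial derivatives up to
    order m in the class K.  The class is a parameter because the derivatives of
    V are controlled only jointly with those of A: sums and products are formed
    once with no condition on the growth, and again when the growth of each term
    is known. *)
Fixpoint tame n (K : ('cV[R]_n -> R) -> Prop) (m : nat) (f : 'cV[R]_n -> R) : Prop :=
  [/\ forall x, differentiable f x, K f &
      if m is m'.+1 then forall i, tame K m' (pderiv i f) else True].

Section TameTheory.
Variables (n : nat) (K : ('cV[R]_n -> R) -> Prop).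
Implicit Types f g : 'cV[R]_n -> R.

Lemma tame_differentiable m f : tame K m f -> forall x, differentiable f x.
Proof. by case: m => [|m] []. Qed.

Lemma tame_in m f : tame K m f -> K f.
Proof. by case: m => [|m] []. Qed.

Lemma tame_pderiv m f i : tame K m.+1 f -> tame K m (pderiv i f).
Proof. by case=> _ _; apply. Qed.

Lemma tameW m f : tame K m.+1 f -> tame K m f.
Proof.
elim: m f => [|m IH] f; first by case=> df Kf _; split.
by move=> [df Kf tf]; split => // i; exact/IH/tf.
Qed.

Lemma pderivD f g i : (forall x, differentiable f x) -> (forall x, differentiable g x) ->
  pderiv i (fun x => f x + g x) = (fun x => pderiv i f x + pderiv i g x).
Proof.
move=> df dg; apply/funext => x; apply: (@deriveD R _ _ f g x); exact: diff_derivable.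
Qed.

Lemma pderivM f g i : (forall x, differentiable f x) -> (forall x, differentiable g x) ->
  pderiv i (fun x => f x * g x) = (fun x => pderiv i f x * g x + f x * pderiv i g x).
Proof.
move=> df dg; apply/funext => x; rewrite addrC [pderiv i f x * _]mulrC.
by apply: (@deriveM R _ f g x); exact: diff_derivable.
Qed.

Hypothesis KD : forall f g, K f -> K g -> K (fun x => f x + g x).
Hypothesis KM : forall f g, K f -> K g -> K (fun x => f x * g x).
Hypothesis Kcst : forall a, K (fun=> a).

Lemma tame_cst m a : tame K m (fun=> a).
Proof.
elim: m a => [|m IH] a; split => //; try by move=> x; exact: differentiable_cst.
move=> i; rewrite (_ : pderiv i _ = fun=> 0); first exact: IH.
by apply/funext => x; exact: derive_cst.
Qed.

Lemma tameD m f g : tame K m f -> tame K m g -> tame K m (fun x => f x + g x).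
Proof.
elim: m f g => [|m IH] f g [df Kf tf] [dg Kg tg].
  by split => //; [move=> x; exact: differentiableD|exact: KD].
split; [by move=> x; exact: differentiableD|exact: KD|].
by move=> i; rewrite pderivD//; apply: IH; [exact: tf|exact: tg].
Qed.

Lemma tameM m f g : tame K m f -> tame K m g -> tame K m (fun x => f x * g x).
Proof.
elim: m f g => [|m IH] f g.
  move=> [df Kf _] [dg Kg _]; split => //; last exact: KM.
  by move=> x; exact: differentiableM.
move=> tf tg; have [df Kf tdf] := tf; have [dg Kg tdg] := tg.
split; [by move=> x; exact: differentiableM|exact: KM|].
move=> i; rewrite pderivM//.
by apply: tameD; apply: IH; by [exact: tameW|exact: tdf|exact: tdg].
Qed.

Lemma tame_sum m k (f : 'I_k -> 'cV[R]_n -> R) :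
  (forall i, tame K m (f i)) -> tame K m (fun x => \sum_(i < k) f i x).
Proof.
elim: k f => [|k IH] f tf.
  by under eq_fun do rewrite big_ord0; exact: tame_cst.
by under eq_fun do rewrite big_ord_recr /=; apply: tameD => //; exact: IH.
Qed.

End TameTheory.

Section BoundedDerivatives.
Variable n : nat.
Implicit Types f : 'cV[R]_n -> R.

Definition anygrowth : ('cV[R]_n -> R) -> Prop := fun=> True.

Lemma pderivs_rcons (s : seq 'I_n) i f :
  pderivs (rcons s i) f = pderivs s (pderiv i f).
Proof. by rewrite /pderivs foldr_rcons. Qed.

Lemma smooth_tame m f : smooth f -> tame anygrowth m f.
Proof.
elim: m f => [|m IH] f sf; split => //; try exact: (sf [::]).
by move=> i; apply: IH => s x; rewrite -pderivs_rcons.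
Qed.

(** Bounded derivatives of order k and above leave polynomial growth below
    order k, by k integrations. *)
Lemma tame_pgrowth k f : (forall m, tame anygrowth m f) -> bounded_pderivs_from k f ->
  forall m, tame (@pgrowth R n) m f.
Proof.
elim: k f => [|k IHk] f tf bf m.
  elim: m f tf bf => [|m IH] f tf bf.
    split => //; first exact: tame_differentiable (tf 0).
    by have [C fC] := bf [::] isT; exact: pgrowth_bounded fC.
  split; first exact: tame_differentiable (tf 0).
    by have [C fC] := bf [::] isT; exact: pgrowth_bounded fC.
  move=> i; apply: IH => [l|s _]; first exact: tame_pderiv.
  by rewrite -pderivs_rcons; exact: bf.
have ti i : forall m, tame (@pgrowth R n) m (pderiv i f).
  apply: IHk => [l|s sk]; first exact: tame_pderiv.
  by rewrite -pderivs_rcons; apply: bf; rewrite size_rcons.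
have df := tame_differentiable (tf 0).
have gf : pgrowth f by apply: pgrowth_primitive => // i; exact: tame_in (ti i 0).
by case: m => [|m]; split.
Qed.

End BoundedDerivatives.

Local Notation slow n m := (tame (@pgrowth R n) m).

Lemma slow_sqnorm n k m (F : 'cV[R]_n -> 'cV[R]_k) :
  (forall i, slow n m (component F i)) -> slow n m (fun y => sqnorm (F y)).
Proof.
move=> tF; under eq_fun do rewrite sqnormE.
apply: tame_sum => [f g|a|i]; [exact: pgrowthD|exact: pgrowth_cst|].
by under eq_fun do rewrite expr2; apply: tameM;
  [exact: pgrowthD|exact: pgrowthM|exact: tF|exact: tF].
Qed.

Lemma slow_lincomb n m k (f : 'I_k -> 'cV[R]_n -> R) (a : 'I_k -> R) :
  (forall i, slow n m (f i)) -> slow n m (fun y => \sum_i a i * f i y).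
Proof.
move=> tf; apply: tame_sum => [g h|c|i]; [exact: pgrowthD|exact: pgrowth_cst|].
apply: tameM => //; [exact: pgrowthD|exact: pgrowthM|].
by apply: tame_cst => c; exact: pgrowth_cst.
Qed.

(** The derivatives of V are bounded only after |A|^2 / 2 has been added.  The
    sum has polynomial growth, so has |A|^2 because the derivatives of A are
    bounded, and V is their difference. *)
Lemma slow_potentials d (A : 'cV[R]_d -> 'cV[R]_d) (V : 'cV[R]_d -> R) m :
  (forall i, smooth (component A i)) -> smooth V ->
  bounded_pderivs_from 2 (fun x => V x + 1 / 2 * sqnorm (A x)) ->
  (forall i, bounded_pderivs_from 1 (component A i)) ->
  (forall i, slow d m (component A i)) /\ slow d m V.
Proof.
move=> sA sV bV bA.
have tA l i : slow d l (component A i).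
  by apply: tame_pgrowth (bA i) l => k; exact: smooth_tame.
split=> [|]; first exact: tA.
pose g x := V x + 1 / 2 * sqnorm (A x).
have tg : slow d m g.
  apply: tame_pgrowth bV m => k; apply: tameD => //; first exact: smooth_tame.
  apply: tameM => //; first exact: tame_cst.
  under eq_fun do rewrite sqnormE.
  apply: tame_sum => // i; under eq_fun do rewrite expr2.
  by apply: tameM => //; exact: smooth_tame (sA i).
rewrite (_ : V = fun x => g x + - (1 / 2) * sqnorm (A x)); last first.
  by apply/funext => x; rewrite /g; ring.
apply: tameD => //; first exact: pgrowthD.
apply: tameM; [exact: pgrowthD|exact: pgrowthM| |].
  by apply: tame_cst => a; exact: pgrowth_cst.
exact: slow_sqnorm.
Qed.

End Tame.

(** * Gaussian averages *)

Section Average.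
Variables (R : realType) (d : nat).
Implicit Types (x h : 'cV[R]_(bigdim d)).

Definition Zpart x : 'M[R]_(d, d + d) := row_mx (X1part x) (X2part x).

Definition sample_point x t : 'cV[R]_d := qpart x + Zpart x *m tvec t.

Lemma tvec_zeta (t : Rtuple R (d + d)) : tvec t = col_mx (zeta1 t) (zeta2 t).
Proof.
apply/matrixP => i j; rewrite ord1 !mxE; case: split_ordP => k ->; rewrite mxE //.
Qed.

Lemma sample_pointE x t :
  qpart x + X1part x *m zeta1 t + X2part x *m zeta2 t = sample_point x t.
Proof. by rewrite /sample_point tvec_zeta mul_row_col addrA. Qed.

Lemma gauss_zeta (t : Rtuple R (d + d)) :
  expR (- (1 / 2) * (sqnorm (zeta1 t) + sqnorm (zeta2 t))) = gauss t.
Proof.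
by rewrite /gauss tvec_zeta /sqnorm /dot tr_col_mx mul_row_col [in RHS]mxE.
Qed.

Lemma averageE (f : 'cV[R]_d -> R) x :
  average f x = (2 * pi) ^- d *
    \int[lebesgue_Rn R (d + d)]_t (f (sample_point x t) * gauss t).
Proof.
by congr (_ * _); congr Rintegral; apply/funext => t; rewrite sample_pointE gauss_zeta.
Qed.

Lemma unvecE (v : 'cV[R]_(d * d)) i j : unvec v i j = v (mxvec_index j i) 0.
Proof. by rewrite !mxE. Qed.

Lemma qpartD x h : qpart (x + h) = qpart x + qpart h.
Proof. exact: linearD. Qed.

Lemma qpartZ (a : R) x : qpart (a *: x) = a *: qpart x.
Proof. exact: linearZ. Qed.

Lemma X1partD x h : X1part (x + h) = X1part x + X1part h.
Proof. by apply/matrixP => i j; rewrite [RHS]mxE ?[(_ *: _) i j]mxE !unvecE !mxE. Qed.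

Lemma X1partZ (a : R) x : X1part (a *: x) = a *: X1part x.
Proof. by apply/matrixP => i j; rewrite [RHS]mxE ?[(_ *: _) i j]mxE !unvecE !mxE. Qed.

Lemma X2partD x h : X2part (x + h) = X2part x + X2part h.
Proof. by apply/matrixP => i j; rewrite [RHS]mxE ?[(_ *: _) i j]mxE !unvecE !mxE. Qed.

Lemma X2partZ (a : R) x : X2part (a *: x) = a *: X2part x.
Proof. by apply/matrixP => i j; rewrite [RHS]mxE ?[(_ *: _) i j]mxE !unvecE !mxE. Qed.

Lemma ZpartD x h : Zpart (x + h) = Zpart x + Zpart h.
Proof. by rewrite /Zpart X1partD X2partD add_row_mx. Qed.

Lemma ZpartZ (a : R) x : Zpart (a *: x) = a *: Zpart x.
Proof. by rewrite /Zpart X1partZ X2partZ scale_row_mx. Qed.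

Lemma sample_pointD x h t : sample_point (x + h) t = sample_point x t + sample_point h t.
Proof. by rewrite /sample_point qpartD ZpartD mulmxDl addrACA. Qed.

Lemma sample_pointZ (a : R) x t : sample_point (a *: x) t = a *: sample_point x t.
Proof. by rewrite /sample_point qpartZ ZpartZ -scalemxAl scalerDr. Qed.

Lemma sample_point_sum x t : sample_point x t = \sum_k x k 0 *: sample_point (delta_mx k 0) t.
Proof.
pose L : 'cV[R]_(bigdim d) -> 'cV[R]_d := fun y => sample_point y t.
have LD : {morph L : y z / y + z} by move=> y z; exact: sample_pointD.
have L0 : L 0 = 0 by rewrite -(scale0r 0) /L sample_pointZ scale0r.
rewrite -[LHS]/(L x) {1}[x]matrix_sum_delta (big_morph L LD L0).
by apply: eq_bigr => k _; rewrite big_ord1 /L sample_pointZ.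
Qed.

Lemma norm_sample_point x t : `|sample_point x t| <= `|x| * size_bound t.
Proof.
have s1 := size_bound_ge1 t.
apply: norm_le_coord => [|i j]; first by rewrite mulr_ge0// (le_trans ler01 s1).
rewrite ord1 mxE (le_trans (ler_normD _ _))//.
apply: (@le_trans _ _ (`|x| * (1 + \sum_(k < d + d) `|tnth t k|))); last first.
  by rewrite ler_wpM2l// size_bound_ge.
rewrite mulrDr mulr1 lerD//; first by rewrite mxE; exact: coord_le_norm.
rewrite mxE mulr_sumr (le_trans (ler_norm_sum _ _ _))// ler_sum// => k _.
rewrite normrM [tvec _ _ _]mxE ler_wpM2r// /Zpart.
by case: (split_ordP k) => l ->; rewrite ?row_mxEl ?row_mxEr unvecE !mxE;
  exact: coord_le_norm.
Qed.

Lemma measurable_sample_point x (i : 'I_d) :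
  measurable_fun [set: Rtuple R (d + d)] (fun t => sample_point x t i 0).
Proof.
under eq_fun do rewrite mxE [X in _ + X]mxE.
apply: measurable_funD => //; apply: measurable_sum => k.
by apply: measurable_funM => //; exact: measurable_tvec.
Qed.

(** An open set is a countable union of rational boxes, and the preimage of a
    box is cut out by finitely many conditions on single coordinates. *)
Lemma measurable_continuous_comp disp (T : measurableType disp) n
    (f : 'cV[R]_n -> R) (phi : T -> 'cV[R]_n) :
  continuous f ->
  (forall i, measurable_fun [set: T] (fun t => phi t i 0)) ->
  measurable_fun [set: T] (f \o phi).
Proof.
move=> cf mphi.
pose box (cr : 'cV[rat]_n * rat) : set T :=
  \bigcap_(i in [set: 'I_n])
    [set t | ratr (cr.1 i 0) - ratr cr.2 < phi t i 0 < ratr (cr.1 i 0) + ratr cr.2].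
have mbox cr : measurable (box cr).
  apply: fin_bigcap_measurable => // i _.
  have -> : [set t | ratr (cr.1 i 0) - ratr cr.2 < phi t i 0 < ratr (cr.1 i 0) + ratr cr.2] =
    [set: T] `&` (fun t => phi t i 0) @^-1`
      `]ratr (cr.1 i 0) - ratr cr.2, ratr (cr.1 i 0) + ratr cr.2[.
    by rewrite setTI; apply/seteqP; split => t /=; rewrite in_itv.
  by apply: mphi => //; exact: measurable_itv.
apply: (measurability _ (RGenOpens.measurableE R)) => //.
move=> _ [_ [a [b ->] <-]]; rewrite setTI.
pose U := f @^-1` `]a, b[.
have oU : open U by apply: open_comp => // x _; exact: cf.
pose inside (cr : 'cV[rat]_n * rat) :=
  forall x : 'cV[R]_n,
    (forall i, ratr (cr.1 i 0) - ratr cr.2 < x i 0 < ratr (cr.1 i 0) + ratr cr.2) -> U x.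
rewrite (_ : _ @^-1` _ = \bigcup_cr (if `[< inside cr >] then box cr else set0)).
  apply: countable_bigcupT_measurable => // cr.
  by case: ifP.
apply/seteqP; split => t /=; last first.
  by move=> [cr _]; case: asboolP => // ins bt; apply: ins => i; exact: bt.
move=> Ut; have /nbhs_ballP[e /= e0 eU] := open_nbhs_nbhs (conj oU (Ut : U (phi t))).
have [r] : exists r : rat, 0 < (ratr r : R) < e / 2.
  have /rat_in_itvoo[r] : 0 < e / 2 by rewrite divr_gt0.
  by rewrite in_itv => r0; exists r.
move=> /andP[r0 re].
have [c cP] : exists c : 'cV[rat]_n,
    forall i, phi t i 0 - ratr r < ratr (c i 0) < phi t i 0 + ratr r.
  have [|c cP] := @fin_all_exists _ _ (fun (i : 'I_n) q =>
      phi t i 0 - ratr r < ratr q < phi t i 0 + ratr r).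
    move=> i; have /rat_in_itvoo[q] : phi t i 0 - ratr r < phi t i 0 + ratr r.
      by rewrite ltrBlDr -addrA ltrDl addr_gt0.
    by rewrite in_itv => ?; exists q.
  by exists (\col_i c i) => i; rewrite mxE.
exists (c, r) => //; case: asboolP => [_|[]].
  by move=> i _ /=; have := cP i; lra.
move=> x /= xc; apply: eU.
rewrite -ball_normE /= (le_lt_trans _ (_ : 2 * ratr r < e))//; last by lra.
apply: norm_le_coord; first by rewrite mulr_ge0// ltW.
move=> i j; rewrite !ord1 !mxE ler_norml; have := cP i; have := xc i; lra.
Qed.

Lemma growth_sample_point (M : nat) (f : 'cV[R]_d -> R) x (t : Rtuple R (d + d)) : growth M f ->
  `|f (sample_point x t)| <= M%:R * (1 + `|x|) ^+ M * size_bound t ^+ M.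
Proof.
move=> fM; have s1 := size_bound_ge1 t; have s0 := le_trans ler01 s1.
apply: (le_trans (fM _)); rewrite -mulrA ler_wpM2l// -exprMn.
rewrite lerXn2r ?nnegrE ?mulr_ge0 ?addr_ge0//.
by rewrite mulrDl mul1r lerD// norm_sample_point.
Qed.

Lemma measurable_comp_sample_point (f : 'cV[R]_d -> R) x : (forall y, differentiable f y) ->
  measurable_fun [set: Rtuple R (d + d)] (fun t => f (sample_point x t)).
Proof.
move=> df; apply: measurable_continuous_comp; last exact: measurable_sample_point.
by move=> y; exact: differentiable_continuous.
Qed.

Lemma integrable_comp_sample_point (f : 'cV[R]_d -> R) x :
  (forall y, differentiable f y) -> pgrowth f ->
  (lebesgue_Rn R (d + d)).-integrable setT
    (EFin \o (fun t => f (sample_point x t) * gauss t)).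
Proof.
move=> df [M fM]; apply: (@integrable_gaussM _ _ _ (M%:R * (1 + `|x|) ^+ M) M).
  exact: measurable_comp_sample_point.
by move=> t; exact: growth_sample_point.
Qed.

(** The Taylor remainder of f at q + Z zeta is quadratic in the increment h,
    with a factor that is polynomial in zeta.  Integrated against the Gaussian
    it is still O(|h|^2), while the first order term integrates to a linear
    function of h. *)
Lemma differentiable_average (f : 'cV[R]_d -> R) x :
  tame (@pgrowth R d) 2 f -> differentiable (average f) x.
Proof.
move=> tf; have df := tame_differentiable tf.
have ddf i := tame_differentiable (tame_pderiv i tf).
have gf := tame_in tf; have gdf i := tame_in (tame_pderiv i tf).
have [M fM] : exists M : nat, forall y h : 'cV[R]_d,
    `|f (y + h) - f y - \sum_i h i 0 * pderiv i f y|
      <= M%:R * (1 + `|y| + `|h|) ^+ M * `|h| ^+ 2.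
  apply: taylor_bound => // i j.
  exact: tame_in (tame_pderiv j (tame_pderiv i tf)).
pose mu := lebesgue_Rn R (d + d).
pose F y := \int[mu]_t (f (sample_point y t) * gauss t).
pose Df (y h : 'cV[R]_(bigdim d)) (t : Rtuple R (d + d)) :=
  \sum_(i < d) sample_point h t i 0 * pderiv i f (sample_point y t).
have DfE y h t : Df y h t = \sum_k h k 0 * Df y (delta_mx k 0) t.
  rewrite /Df; under [RHS]eq_bigr do rewrite mulr_sumr.
  rewrite exchange_big /=; apply: eq_bigr => i _.
  rewrite sample_point_sum summxE mulr_suml; apply: eq_bigr => k _.
  by rewrite mxE mulrA.
have iDf y h : mu.-integrable setT (EFin \o (fun t => Df y h t * gauss t)).
  have [N dN] := uniform_growth gdf.
  apply: (@integrable_gaussM _ _ _ (d%:R * `|h| * (N%:R * (1 + `|y|) ^+ N)) N.+1).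
    apply: measurable_sum => i; apply: measurable_funM; first exact: measurable_sample_point.
    exact: measurable_comp_sample_point.
  move=> t; apply: (le_trans (ler_norm_sum _ _ _)).
  have s0 := le_trans ler01 (size_bound_ge1 t).
  apply: (@le_trans _ _ (\sum_(i < d) (`|h| * size_bound t) *
     (N%:R * (1 + `|y|) ^+ N * size_bound t ^+ N))).
    apply: ler_sum => i _; rewrite normrM ler_pM//; last exact: growth_sample_point.
    by apply: le_trans (norm_sample_point _ _); exact: coord_le_norm.
  rewrite sumr_const card_ord -[leLHS]mulr_natl exprS.
  by rewrite le_eqVlt; apply/orP; left; apply/eqP; ring.
(* The gradient: the average of the directional derivatives along the axes. *)
pose w k := \int[mu]_t (Df x (delta_mx k 0) t * gauss t).
pose rem (h : 'cV[R]_(bigdim d)) (t : Rtuple R (d + d)) :=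
  f (sample_point (h + x) t) - f (sample_point x t) - Df x h t.
have remE h : F (h + x) - F x - \sum_k h k 0 * w k = \int[mu]_t (rem h t * gauss t).
  have -> : \sum_k h k 0 * w k = \int[mu]_t (Df x h t * gauss t).
    rewrite /w; under eq_bigr do rewrite -RintegralZl//.
    have [|_ <-] := @Rintegral_sum _ _ _ (fun k t => h k 0 * (Df x (delta_mx k 0) t * gauss t)).
      move=> k; have := integrableZl measurableT (h k 0) (iDf x (delta_mx k 0)).
      exact: eq_integrable.
    apply: eq_Rintegral => t _; rewrite DfE mulr_suml.
    by apply: eq_bigr => k _; rewrite mulrA.
  have iF y : mu.-integrable setT (EFin \o (fun t => f (sample_point y t) * gauss t)).
    exact: integrable_comp_sample_point.
  rewrite /F -RintegralB// -RintegralB//; last first.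
    by have := integrableB measurableT (iF (h + x)) (iF x); exact: eq_integrable.
  by apply: eq_Rintegral => t _; rewrite /rem !mulrBl.
(* The base 2 + |x| adds 1 and |h| <= 1 to |x|, each times size_bound t. *)
pose C := M%:R * (2 + `|x|) ^+ M.
have rem_le h t : `|h| <= 1 -> `|rem h t| <= `|h| ^+ 2 * (C * size_bound t ^+ (M + 2)).
  move=> h1; rewrite /rem [h + x]addrC sample_pointD.
  have s1 := size_bound_ge1 t; have s0 := le_trans ler01 s1.
  have dx := norm_sample_point x t; have dh := norm_sample_point h t.
  have dh1 : `|sample_point h t| <= size_bound t by apply: le_trans dh _; rewrite ler_piMl.
  apply: (le_trans (fM _ _)).
  rewrite mulrC; apply: (@le_trans _ _ ((`|h| * size_bound t) ^+ 2 *
     (M%:R * ((2 + `|x|) * size_bound t) ^+ M))).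
    rewrite ler_pM ?mulr_ge0 ?exprn_ge0 ?addr_ge0//.
      by rewrite lerXn2r ?nnegrE ?mulr_ge0.
    rewrite ler_wpM2l// lerXn2r ?nnegrE ?mulr_ge0 ?addr_ge0//; lra.
  rewrite le_eqVlt; apply/orP; left; apply/eqP.
  by rewrite /C !exprMn exprD; ring.
pose S := \int[mu]_t (C * (size_bound t ^+ (M + 2) * gauss t)).
have iS : mu.-integrable setT (EFin \o (fun t => C * (size_bound t ^+ (M + 2) * gauss t))).
  have := integrableZl measurableT C (@integrable_size_gauss R (d + d) (M + 2)).
  exact: eq_integrable.
have irem h : mu.-integrable setT (EFin \o (fun t => rem h t * gauss t)).
  have i1 := integrableB measurableT (@integrable_comp_sample_point f (h + x) df gf)
    (@integrable_comp_sample_point f x df gf).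
  have := integrableB measurableT i1 (iDf x h).
  by apply: eq_integrable => // t _; rewrite /rem /= !mulrBl.
pose G y := F y - F x - \sum_k (y - x) k 0 * w k.
have dG : differentiable G x.
  apply: (@differentiable_quadratic _ _ _ _ S) => h h1.
  rewrite /G addrK remE (le_trans (le_normr_Rintegral _ _))//.
  rewrite mulrC /S -RintegralZl//; apply: le_Rintegral => //.
  - have := integrable_norm (irem h); exact: eq_integrable.
  - have := integrableZl measurableT (`|h| ^+ 2) iS; exact: eq_integrable.
  move=> t _; rewrite normrM (ger0_norm (gauss_ge0 t)).
  rewrite [C * _]mulrA [leRHS]mulrA ler_wpM2r ?gauss_ge0//; exact: rem_le.
have aE y : average f y = (2 * pi) ^- d * F y by exact: averageE.
rewrite (_ : average f = fun y => (2 * pi) ^- d *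
   (G y + \sum_k (y - x) k 0 * w k + F x)); last first.
  by apply/funext => y; rewrite aE /G !subrK.
apply: differentiableM; first exact: differentiable_cst.
apply: differentiableD; last exact: differentiable_cst.
apply: differentiableD => //.
rewrite (_ : (fun y => _) =
    \sum_(k < bigdim d) (fun y : 'cV[R]_(bigdim d) => (y - x) k 0 * w k));
  last by apply/funext => y; rewrite fct_sumE.
apply: differentiable_sum => k; apply: differentiableM; last exact: differentiable_cst.
under eq_fun do rewrite !mxE.
by apply: differentiableB; [exact: differentiable_coord|exact: differentiable_cst].
Qed.

End Average.

(** * Conservation of momentum maps by the substeps *)

Section Noether.
Variable R : realType.

Lemma dotE n (u v : 'cV[R]_n) : dot u v = \sum_i u i 0 * v i 0.
Proof. by rewrite /dot mxE; apply: eq_bigr => i _; rewrite mxE. Qed.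

Lemma dotC n (u v : 'cV[R]_n) : dot u v = dot v u.
Proof. by rewrite !dotE; apply: eq_bigr => i _; rewrite mulrC. Qed.

Lemma dotDl n (u v w : 'cV[R]_n) : dot (u + v) w = dot u w + dot v w.
Proof. by rewrite /dot linearD /= mulmxDl mxE. Qed.

Lemma dotDr n (u v w : 'cV[R]_n) : dot w (u + v) = dot w u + dot w v.
Proof. by rewrite /dot mulmxDr mxE. Qed.

Lemma dotZl n (a : R) (u v : 'cV[R]_n) : dot (a *: u) v = a * dot u v.
Proof. by rewrite /dot linearZ /= -scalemxAl mxE. Qed.

Lemma dotZr n (a : R) (u v : 'cV[R]_n) : dot u (a *: v) = a * dot u v.
Proof. by rewrite dotC dotZl dotC. Qed.

Lemma dotNr n (u v : 'cV[R]_n) : dot u (- v) = - dot u v.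
Proof. by rewrite -scaleN1r dotZr mulN1r. Qed.

Lemma dotNl n (u v : 'cV[R]_n) : dot (- u) v = - dot u v.
Proof. by rewrite dotC dotNr dotC. Qed.

Lemma dot0r n (u : 'cV[R]_n) : dot u 0 = 0.
Proof. by rewrite /dot mulmx0 mxE. Qed.

Lemma dot0l n (u : 'cV[R]_n) : dot 0 u = 0.
Proof. by rewrite dotC dot0r. Qed.

Lemma dot_suml n m (u : 'I_m -> 'cV[R]_n) v :
  dot (\sum_i u i) v = \sum_i dot (u i) v.
Proof.
by apply: (big_morph (fun u => dot u v)) => [x y|]; [exact: dotDl|exact: dot0l].
Qed.

Lemma dot_sumr n m (u : 'I_m -> 'cV[R]_n) v :
  dot v (\sum_i u i) = \sum_i dot v (u i).
Proof. by rewrite dotC dot_suml; apply: eq_bigr => i _; rewrite dotC. Qed.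

Lemma dot_trmx m n (B : 'M[R]_(m, n)) u v : dot u (B^T *m v) = dot (B *m u) v.
Proof. by rewrite /dot trmx_mul mulmxA. Qed.

(** With all b_i nonzero this is the condition under which a partitioned
    Runge-Kutta method preserves bilinear invariants. *)
Lemma conjugate_tableauE s (L : 'M[R]_s) (b : 'cV[R]_s) i j :
  (forall i, b i 0 != 0) ->
  b i 0 * conjugate_tableau L b i j = b i 0 * b j 0 - L j i * b j 0.
Proof.
move=> b0.
have ub : diag_mx b^T \in unitmx.
  rewrite unitmxE det_diag unitfE prodf_seq_neq0; apply/allP => k _.
  by rewrite mxE b0.
have -> : b i 0 * conjugate_tableau L b i j =
    (diag_mx b^T *m conjugate_tableau L b) i j by rewrite mul_diag_mx !mxE.
rewrite mulmxBr -!mulmxA mulKVmx// mul_diag_mx mul_mx_diag !mxE big_ord1 !mxE.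
by rewrite mul1r.
Qed.

Section PRK.
Variables (s : nat) (L : 'M[R]_s) (b : 'cV[R]_s).
Hypotheses (explicitL : explicit_tableau L) (b0 : forall i, b i 0 != 0).

Lemma stage_point_explicit n tau (y : 'cV[R]_n) k i :
  stage_point L tau y k i = y + tau *: \sum_j L i j *: k j.
Proof.
congr (_ + _ *: _); rewrite [RHS](bigID (fun j : 'I_s => (j < i)%N))/=.
rewrite [X in _ = _ + X]big1 ?addr0// => j; rewrite -leqNgt => ij.
by rewrite explicitL// scale0r.
Qed.

(** The hypothesis says that at every stage the bilinear form has derivative
    zero, evaluated at the stage values.  Expressing these through the initial
    values, the terms of order tau in the update become minus tau^2 times the
    double sum of b_i b_j (M k_i) . l_j, which is the term of order tau^2 with
    the opposite sign. *)
Lemma partitioned_rk_conserves (n : nat) (M : {linear 'cV[R]_n -> 'cV[R]_n})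
    (u : 'cV[R]_n) (tau : R) (q p : 'cV[R]_n) (k l : 'I_s -> 'cV[R]_n) :
  (forall i, dot (M (stage_point L tau q k i) + u) (l i) +
     dot (M (k i)) (p + tau *: \sum_j conjugate_tableau L b i j *: l j) = 0) ->
  dot (M (rk_update b tau q k) + u) (rk_update b tau p l) = dot (M q + u) p.
Proof.
move=> stage; pose g i j := dot (M (k i)) (l j).
have {}stage i : dot (M q + u) (l i) + dot (M (k i)) p =
    - tau * \sum_j (L i j * g j i + conjugate_tableau L b i j * g i j).
  have := stage i; rewrite stage_point_explicit linearD linearZ linear_sum /=.
  rewrite addrAC dotDl dotZl dot_suml dotDr dotZr dot_sumr big_split /=.
  under eq_bigr do rewrite linearZ dotZl -/(g _ _).
  under [X in _ + (_ + _ * X)]eq_bigr do rewrite dotZr -/(g _ _).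
  lra.
rewrite /rk_update linearD linearZ linear_sum /= addrAC.
under eq_bigr do rewrite linearZ.
pose D := \sum_i \sum_j b i 0 * b j 0 * g i j.
have E1 : dot (M q + u) (\sum_i b i 0 *: l i) + dot (\sum_i b i 0 *: M (k i)) p = - tau * D.
  rewrite dot_sumr dot_suml -big_split /=.
  under eq_bigr => i _.
    rewrite dotZr dotZl -mulrDr stage mulrCA; over.
  rewrite -mulr_sumr; congr (_ * _).
  under eq_bigr do rewrite mulr_sumr.
  under eq_bigr do under eq_bigr do rewrite mulrDr.
  under eq_bigr do rewrite big_split /=.
  rewrite big_split /= exchange_big -big_split /=; apply: eq_bigr => i _.
  rewrite -big_split /=; apply: eq_bigr => j _.
  rewrite [X in _ + X]mulrA conjugate_tableauE//; ring.
have E2 : dot (\sum_i b i 0 *: M (k i)) (\sum_j b j 0 *: l j) = D.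
  rewrite dot_suml; apply: eq_bigr => i _; rewrite dot_sumr; apply: eq_bigr => j _.
  by rewrite dotZl dotZr mulrA.
rewrite dotDl !dotDr !dotZl !dotZr E2.
transitivity (dot (M q + u) p + tau * (- tau * D) + tau * (tau * D)); last by ring.
by rewrite -E1; ring.
Qed.

End PRK.

Lemma is_derive_dot n (f g : R -> 'cV[R]_n) t u v :
  is_derive t (1 : R) f u -> is_derive t (1 : R) g v ->
  is_derive t (1 : R) (fun r => dot (f r) (g r)) (dot u (g t) + dot (f t) v).
Proof.
move=> df dg.
rewrite (_ : (fun r => _) = \sum_(i < n) (fun r => f r i 0 * g r i 0)); last first.
  by apply/funext => r; rewrite dotE fct_sumE.
have di i : is_derive t (1 : R) (fun r => f r i 0 * g r i 0)
    (u i 0 * g t i 0 + f t i 0 * v i 0).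
  have dfi := is_derive_coord i 0 df; have dgi := is_derive_coord i 0 dg.
  apply: (is_derive_eq (is_deriveM dfi dgi)).
  by rewrite addrC /GRing.scale /= [_ * u i 0]mulrC.
apply: (is_derive_eq (is_derive_sum di)).
by rewrite !dotE -big_split.
Qed.

Lemma is_derive_linear m n (f : {linear 'cV[R]_n -> 'cV[R]_m}) (c : R -> 'cV[R]_n) t v :
  is_derive t (1 : R) c v -> is_derive t (1 : R) (fun r => f (c r)) (f v).
Proof.
move=> dc; apply: is_derive_mx => i j; rewrite ord1.
have fE x : f x i 0 = dot x (\col_k f (delta_mx k 0) i 0).
  rewrite dotE [in LHS](matrix_sum_delta x) linear_sum summxE.
  by apply: eq_bigr => k _; rewrite big_ord1 linearZ !mxE.
under eq_fun do rewrite fE; rewrite fE.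
apply: (is_derive_eq (is_derive_dot dc (is_derive_cst _ _ _))).
by rewrite dot0r addr0.
Qed.

Lemma grad_half_sqr n (p : 'cV[R]_n) : grad (fun x => 1 / 2 * dot x x) p = p.
Proof.
apply/matrixP => i j; rewrite ord1 mxE /pderiv.
rewrite (_ : (fun x => _) =
    (1 / 2) *: \sum_(k < n) (fun x : 'cV[R]_n => x k 0 * x k 0)); last first.
  by apply/funext => x; rewrite dotE fctE fct_sumE.
have dk (k : 'I_n) : is_derive p (delta_mx i 0) (fun x : 'cV[R]_n => x k 0 * x k 0)
    (2 * p k 0 * (i == k)%:R).
  have dc : is_derive p (delta_mx i 0) (fun x : 'cV[R]_n => x k 0) (i == k)%:R.
    have := is_derive_coord k 0 (is_derive_id p (delta_mx i 0)).
    by rewrite mxE eqxx andbT eq_sym.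
  apply: (is_derive_eq (is_deriveM dc dc)).
  by rewrite /GRing.scale /=; ring.
have ds := is_deriveZ (1 / 2) (is_derive_sum dk).
rewrite (@derive_val _ _ _ _ _ _ _ ds) (bigD1 i)//= big1 => [|k ki].
  by rewrite eqxx addr0 /GRing.scale /=; field.
by rewrite eq_sym (negPf ki) mulr0.
Qed.

Lemma grad_cst n (a : R) (x : 'cV[R]_n) : grad (fun=> a) x = 0.
Proof. by apply/matrixP => i j; rewrite !mxE /pderiv derive_cst. Qed.

Section Substeps.
Variable d : nat.
Local Notation E := ('cV[R]_(bigdim d)).
Variables (A : 'cV[R]_d -> 'cV[R]_d) (V : 'cV[R]_d -> R).
Variables (M : {linear E -> E}) (u : E).
Hypothesis skewM : forall x y, dot (M x) y = - dot x (M y).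
Hypothesis invV : forall x, dot (M x + u) (grad (bigV A V) x) = 0.
Hypothesis invA : forall x, jacobi (bigA A) x *m (M x + u) = M (bigA A x).

Definition noether (z : phase R d) : R := dot (M z.1 + u) z.2.

Lemma exact_substep_conserves k tau z z' : k <> Mag ->
  exact_substep A V k tau z z' -> noether z' = noether z.
Proof.
move=> kM [c [c0 dc] <-]; rewrite -c0.
have d1 t : is_derive t (1 : R) (fun r => (c r).1)
    (hamiltonian_field (sub_hamiltonian A V k) (c t)).1.
  by apply: (is_derive_continuous_linear _ (dc t)) => y; exact: cvg_fst.
have d2 t : is_derive t (1 : R) (fun r => (c r).2)
    (hamiltonian_field (sub_hamiltonian A V k) (c t)).2.
  by apply: (is_derive_continuous_linear _ (dc t)) => y; exact: cvg_snd.
have dI t : is_derive t (1 : R) (noether \o c)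
    (dot (M (hamiltonian_field (sub_hamiltonian A V k) (c t)).1) (c t).2 +
     dot (M (c t).1 + u) (hamiltonian_field (sub_hamiltonian A V k) (c t)).2).
  apply: (is_derive_eq (is_derive_dot (is_deriveD (is_derive_linear M (d1 t))
    (is_derive_cst u t 1)) (d2 t))).
  by rewrite addr0.
have dI0 t : is_derive t (1 : R) (noether \o c) 0.
  apply: (is_derive_eq (dI t)).
  case: k kM {d1 d2 dI dc} => //= _.
    rewrite grad_half_sqr grad_cst oppr0 dot0r addr0.
    have := skewM (c t).2 (c t).2; rewrite [in RHS]dotC; lra.
  by rewrite grad_cst linear0 dot0l add0r dotNr invV oppr0.
exact: (is_derive_0_is_cst _ _ dI0).
Qed.

Lemma magnetic_prk_conserves s (L : 'M[R]_s) (b : 'cV[R]_s) tau z z' :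
  explicit_tableau L -> (forall i, b i 0 != 0) ->
  magnetic_prk A L (conjugate_tableau L b) b tau z z' -> noether z' = noether z.
Proof.
move=> eL b0 [k [l [kE lE _ ->]]]; apply: (partitioned_rk_conserves eL) => // i.
rewrite (lE i) dot_trmx invA (kE i) linearN dotNl.
by rewrite subrr.
Qed.

Lemma compose_substeps_conserves s (L : 'M[R]_s) (b : 'cV[R]_s) scheme tau z z' :
  explicit_tableau L -> (forall i, b i 0 != 0) ->
  compose_substeps (numeric_substep A V L (conjugate_tableau L b) b) scheme tau z z' ->
  noether z' = noether z.
Proof.
move=> eL b0; elim: scheme z => [z ->//|[k c] rest IH z /= [y zy /IH ->]].
case: k zy => /=; last exact: magnetic_prk_conserves.
- by apply: exact_substep_conserves.
- by apply: exact_substep_conserves.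
Qed.

End Substeps.

End Noether.

(** * From finite to infinitesimal symmetries *)

Section Infinitesimal.
Variable R : realType.

Lemma gradient_chain_rule n (f : 'cV[R]_n -> R) (c : R -> 'cV[R]_n) t v :
  differentiable f (c t) -> is_derive t (1 : R) c v ->
  is_derive t (1 : R) (f \o c) (dot v (grad f (c t))).
Proof.
move=> df dc; apply: (is_derive_eq (is_derive_along df dc)).
by rewrite dotE; apply: eq_bigr => k _; rewrite mxE.
Qed.

(** The factor 2 is the rate of the angle with respect to the tangent of its
    half. *)
Lemma is_derive_circle_sin : is_derive (0 : R) (1 : R) (@circle_sin R) 2.
Proof.
have di := is_derive_id (0 : R) (1 : R).
have d1 : is_derive (0 : R) (1 : R) (fun u : R => 2 * u) 2.
  by apply: (is_derive_eq (is_deriveZ 2 di)); rewrite /GRing.scale /= mulr1.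
have d2 : is_derive (0 : R) (1 : R) (fun u : R => (1 + u ^+ 2)^-1) 0.
  have d3 : is_derive (0 : R) (1 : R) (fun u : R => 1 + u ^+ 2) 0.
    have d4 := is_deriveD (is_derive_cst (1 : R) (0 : R) (1 : R)) (is_deriveM di di).
    by apply: (is_derive_eq d4); rewrite /GRing.scale /= mul0r !addr0.
  have n0 : 1 + (0 : R) ^+ 2 != 0 by rewrite expr0n addr0 oner_neq0.
  apply: (is_derive_eq (@is_deriveV R (fun u : R => 1 + u ^+ 2) 0 0 1 n0 d3)).
  by rewrite scaler0.
apply: (is_derive_eq (is_deriveM d1 d2)).
by rewrite /GRing.scale /= mulr0 add0r expr0n addr0 invr1 mul1r.
Qed.

Section Rotor.
Variables (n : nat) (M : {linear 'cV[R]_n -> 'cV[R]_n}).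

(** The orbit of x under the one-parameter group generated by M when
    M^3 = - M, in the parameter of [rotation]. *)
Definition rotor (x : 'cV[R]_n) (r : R) : 'cV[R]_n :=
  x + circle_sin r *: M x + (r * circle_sin r) *: M (M x).

Lemma rotor0 x : rotor x 0 = x.
Proof. by rewrite /rotor mul0r scale0r /circle_sin mulr0 mul0r scale0r !addr0. Qed.

Lemma is_derive_rotor x : is_derive (0 : R) (1 : R) (rotor x) (2 *: M x).
Proof.
apply: is_derive_mx => i j; have ds := is_derive_circle_sin.
rewrite (_ : (fun r => _) = (fun r => x i j + circle_sin r * M x i j
   + (r * circle_sin r) * M (M x) i j)); last by apply/funext => r; rewrite !mxE.
have dc (a : R) : is_derive (0 : R) (1 : R) (fun _ : R => a) 0 by exact: is_derive_cst.
have d1 := is_deriveM ds (dc (M x i j)).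
have d2 := is_deriveM (is_deriveM (is_derive_id (0 : R) (1 : R)) ds) (dc (M (M x) i j)).
apply: (is_derive_eq (is_deriveD (is_deriveD (dc (x i j)) d1) d2)).
rewrite /GRing.scale /= /circle_sin mxE; ring.
Qed.

Lemma rotor_invariant (f : 'cV[R]_n -> R) x : differentiable f x ->
  (forall r, f (rotor x r) = f x) -> dot (M x) (grad f x) = 0.
Proof.
move=> df fr; have df' : differentiable f (rotor x 0) by rewrite rotor0.
have := is_derive_unique (gradient_chain_rule df' (is_derive_rotor x)).
rewrite (_ : f \o _ = fun=> f x); last by apply/funext => r /=; rewrite fr.
move=> /(_ _ (is_derive_cst _ _ _)); rewrite rotor0 dotZl => /eqP.
by rewrite mulf_eq0 pnatr_eq0 => /eqP.
Qed.

Lemma rotor_equivariant (F : 'cV[R]_n -> 'cV[R]_n) x :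
  (forall i, differentiable (component F i) x) ->
  (forall r, F (rotor x r) = rotor (F x) r) -> jacobi F x *m M x = M (F x).
Proof.
move=> dF Fr; have dF' i : differentiable (component F i) (rotor x 0) by rewrite rotor0.
have := is_derive_unique (chain_rule dF' (is_derive_rotor x)).
rewrite (_ : F \o _ = rotor (F x)); last by apply/funext => r /=; rewrite Fr.
move=> /(_ _ (is_derive_rotor (F x))); rewrite rotor0 -scalemxAr.
by apply: scalerI; rewrite pnatr_eq0.
Qed.

End Rotor.

Lemma line_invariant n (f : 'cV[R]_n -> R) x u : differentiable f x ->
  (forall r, f (x + r *: u) = f x) -> dot u (grad f x) = 0.
Proof.
move=> df fr; have x0 : x + 0 *: u = x by rewrite scale0r addr0.
have df' : differentiable f (x + 0 *: u) by rewrite x0.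
have := gradient_chain_rule df' (is_derive_line x u 0).
rewrite (_ : f \o _ = fun=> f x); last by apply/funext => r /=; rewrite fr.
by rewrite x0 => h; exact: is_derive_unique h (is_derive_cst _ _ _).
Qed.

Lemma line_invariant_mx m n (F : 'cV[R]_n -> 'cV[R]_m) x u :
  (forall i, differentiable (component F i) x) ->
  (forall r, F (x + r *: u) = F x) -> jacobi F x *m u = 0.
Proof.
move=> dF Fr; have x0 : x + 0 *: u = x by rewrite scale0r addr0.
have dF' i : differentiable (component F i) (x + 0 *: u) by rewrite x0.
have := chain_rule dF' (is_derive_line x u 0).
rewrite (_ : F \o _ = fun=> F x); last by apply/funext => r /=; rewrite Fr.
by rewrite x0 => h; exact: is_derive_unique h (is_derive_cst _ _ _).
Qed.

Lemma pderiv_periodic n (f : 'cV[R]_n -> R) (v y : 'cV[R]_n) i :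
  (forall z, f (z + v) = f z) -> pderiv i f (y + v) = pderiv i f y.
Proof.
move=> fv; rewrite /pderiv /derive fv.
have -> // : f \o shift (y + v) = f \o shift y.
by apply/funext => h; rewrite /= addrA fv.
Qed.

End Infinitesimal.

(** * Configurations as a vector and a matrix *)

Section Assemble.
Variables (R : realType) (d : nat).
Implicit Types (x y : 'cV[R]_(bigdim d)) (q : 'cV[R]_d) (Z : 'M[R]_(d, d + d)).

Definition assemble q Z : 'cV[R]_(bigdim d) :=
  col_mx q (col_mx (vec (lsubmx Z)) (vec (rsubmx Z))).

Lemma vecK (X : 'M[R]_d) : unvec (vec X) = X.
Proof. by rewrite /unvec /vec trmxK mxvecK trmxK. Qed.

Lemma unvecK (v : 'cV[R]_(d * d)) : vec (unvec v) = v.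
Proof. by rewrite /unvec /vec trmxK vec_mxK trmxK. Qed.

Lemma unvecZ (a : R) (v : 'cV[R]_(d * d)) : unvec (a *: v) = a *: unvec v.
Proof. by apply/matrixP => i j; rewrite !mxE. Qed.

Lemma qpart_assemble q Z : qpart (assemble q Z) = q.
Proof. by rewrite /qpart col_mxKu. Qed.

Lemma Zpart_assemble q Z : Zpart (assemble q Z) = Z.
Proof.
by rewrite /Zpart /X1part /X2part !col_mxKd !col_mxKu !vecK hsubmxK.
Qed.

Lemma assembleK x : assemble (qpart x) (Zpart x) = x.
Proof.
by rewrite /assemble row_mxKl row_mxKr /X1part /X2part !unvecK !vsubmxK.
Qed.

Lemma eq_parts x y : qpart x = qpart y -> Zpart x = Zpart y -> x = y.
Proof. by move=> qxy Zxy; rewrite -(assembleK x) qxy Zxy assembleK. Qed.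

Lemma assembleD q q' Z Z' :
  assemble q Z + assemble q' Z' = assemble (q + q') (Z + Z').
Proof.
by apply: eq_parts; rewrite ?qpartD ?ZpartD ?qpart_assemble ?Zpart_assemble.
Qed.

Lemma assembleZ (a : R) q Z : a *: assemble q Z = assemble (a *: q) (a *: Z).
Proof.
by apply: eq_parts; rewrite ?qpartZ ?ZpartZ ?qpart_assemble ?Zpart_assemble.
Qed.

Lemma mxtrace_dot (X Y : 'M[R]_d) : dot (vec X) (vec Y) = \tr (X^T *m Y).
Proof.
transitivity (\sum_(p : 'I_d * 'I_d) X p.2 p.1 * Y p.2 p.1).
  rewrite dotE (reindex _ (curry_mxvec_bij d d)) /=.
  by apply: eq_bigr => -[i j] _ /=; rewrite /vec ![_^T _ 0]mxE !mxvecE !mxE.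
rewrite -(pair_bigA _ (fun i j => X j i * Y j i)) /=; apply: eq_bigr => i _.
by rewrite mxE; apply: eq_bigr => j _; rewrite mxE.
Qed.

Lemma dot_assemble q p Z W :
  dot (assemble q Z) (assemble p W) = dot q p + \tr (Z^T *m W).
Proof.
rewrite {1}/dot /assemble !tr_col_mx !mul_row_col mxE; congr (_ + _).
rewrite mxE -[X in X + _]/(dot (vec _) (vec _)) -[X in _ + X]/(dot (vec _) (vec _)).
rewrite !mxtrace_dot -[Z in RHS]hsubmxK -[W in RHS]hsubmxK tr_row_mx mul_col_row.
by rewrite mxtrace_block.
Qed.

End Assemble.

(** * Symmetries of the averaged potentials *)

Local Opaque average lebesgue_Rn.

Section AveragedSymmetry.
Variables (R : realType) (d : nat).
Local Notation E := ('cV[R]_(bigdim d)).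
Local Notation slow m := (tame (@pgrowth R d) m).
Variables (A : 'cV[R]_d -> 'cV[R]_d) (V : 'cV[R]_d -> R).
(* One order more on A than on V: J_A is averaged and then differentiated. *)
Hypothesis tA : forall i, slow 3 (component A i).
Hypothesis tV : slow 2 V.

Lemma slow_A i : slow 2 (component A i).
Proof. exact: tameW. Qed.

Lemma slow_JA i j : slow 2 (fun y => jacobi A y i j).
Proof. by under eq_fun do rewrite mxE; exact: tame_pderiv. Qed.

Lemma slow0 f : slow 2 f -> slow 0 f.
Proof. by move=> tf; exact: tameW (tameW tf). Qed.

Lemma average_lincomb k (f : 'I_k -> 'cV[R]_d -> R) (a : 'I_k -> R) (x : E) :
  (forall i, slow 0 (f i)) ->
  average (fun y => \sum_i a i * f i y) x = \sum_i a i * average (f i) x.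
Proof.
move=> tf; rewrite averageE; under [RHS]eq_bigr do rewrite averageE mulrCA.
rewrite -mulr_sumr; congr (_ * _).
have fi i := @integrable_comp_sample_point R d (f i) x (tame_differentiable (tf i)) (tame_in (tf i)).
under [RHS]eq_bigr do rewrite -RintegralZl//.
have [|_ <-] := @Rintegral_sum R _ _ (fun i t => a i * (f i (sample_point x t) * gauss t)).
  move=> i; have := integrableZl measurableT (a i) (fi i); exact: eq_integrable.
apply: eq_Rintegral => t _; rewrite mulr_suml; apply: eq_bigr => i _.
by rewrite mulrA.
Qed.

Lemma bigA_assemble (x : E) :
  bigA A x = assemble (average_A A x) (average_JA A x *m Zpart x).
Proof. by rewrite /bigA /assemble /Zpart mul_mx_row row_mxKl row_mxKr. Qed.

Lemma differentiable_bigV (x : E) : differentiable (bigV A V) x.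
Proof.
apply: differentiableD; last exact: differentiable_average.
apply: differentiableM; first exact: differentiable_cst.
apply: differentiable_average; apply: slow_sqnorm => i; exact: slow_A.
Qed.

Lemma differentiable_Zpart i j (x : E) : differentiable (fun y : E => Zpart y i j) x.
Proof.
rewrite /Zpart; case: (split_ordP j) => l ->.
  under eq_fun do rewrite row_mxEl unvecE !mxE; exact: differentiable_coord.
under eq_fun do rewrite row_mxEr unvecE !mxE; exact: differentiable_coord.
Qed.

Lemma differentiable_bigA i (x : E) : differentiable (component (bigA A) i) x.
Proof.
have dZ k l : differentiable (fun y : E => (average_JA A y *m Zpart y) k l) x.
  under eq_fun do rewrite mxE.
  rewrite (_ : (fun y => _) = \sum_(j < d) (fun y : E => average_JA A y k j * Zpart y j l));
    last by apply/funext => y; rewrite fct_sumE.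
  apply: differentiable_sum => j; apply: differentiableM; last exact: differentiable_Zpart.
  under eq_fun do rewrite mxE; apply: differentiable_average; exact: slow_JA.
rewrite /component; under eq_fun do rewrite bigA_assemble.
rewrite /assemble; case: (split_ordP i) => j -> .
  under eq_fun do rewrite col_mxEu mxE; apply: differentiable_average; exact: slow_A.
under eq_fun do rewrite col_mxEd.
case: (split_ordP j) => k ->; case/mxvec_indexP: k => a b.
  rewrite (_ : (fun y => _) = fun y => (average_JA A y *m Zpart y) b (lshift d a)).
    exact: dZ.
  by apply/funext => y; rewrite col_mxEu /vec [LHS]mxE mxvecE [LHS]mxE [LHS]mxE.
rewrite (_ : (fun y => _) = fun y => (average_JA A y *m Zpart y) b (rshift d a)).
  exact: dZ.
by apply/funext => y; rewrite col_mxEd /vec [LHS]mxE mxvecE [LHS]mxE [LHS]mxE.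
Qed.

Lemma sample_point_right (g : 'M[R]_(d + d)) (x : E) t :
  sample_point (assemble (qpart x) (Zpart x *m g)) t = sample_point x (mx_act g t).
Proof. by rewrite /sample_point qpart_assemble Zpart_assemble tvec_mx_act mulmxA. Qed.

Lemma gauss_mx_act n (g : 'M[R]_n) t : g^T *m g = 1%:M -> gauss (mx_act g t) = gauss t.
Proof.
move=> go; rewrite /gauss tvec_mx_act /sqnorm -dot_trmx mulmxA go mul1mx //.
Qed.

(** Replacing Z by Z g amounts to replacing the Gaussian variable zeta by
    g zeta, which has the same distribution. *)
Lemma average_right f (g : 'M[R]_(d + d)) (x : E) : slow 0 f ->
  g^T *m g = 1%:M -> preserves_volume g ->
  average f (assemble (qpart x) (Zpart x *m g)) = average f x.
Proof.
move=> sf go gv; set y := assemble _ _.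
have df := tame_differentiable sf; have gf := tame_in sf.
have yE t : f (sample_point y t) * gauss t = f (sample_point x (mx_act g t)) * gauss (mx_act g t).
  by rewrite gauss_mx_act// sample_point_right.
have mf : measurable_fun [set: Rtuple R (d + d)] (fun t => f (sample_point x t) * gauss t).
  apply: measurable_funM; last exact: measurable_gauss.
  exact: measurable_comp_sample_point.
have iy := @integrable_comp_sample_point R d f y df gf; clearbody y.
suff Ey : \int[lebesgue_Rn R (d + d)]_t (f (sample_point y t) * gauss t) =
    \int[lebesgue_Rn R (d + d)]_t (f (sample_point x t) * gauss t).
  by rewrite (averageE f y) Ey -averageE.
rewrite -(Rintegral_mx_act gv mf); first by apply: eq_Rintegral => t _; exact: yE.
by apply: eq_integrable iy => // t _; rewrite /= yE.
Qed.

Lemma bigV_right (g : 'M[R]_(d + d)) (x : E) :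
  g^T *m g = 1%:M -> preserves_volume g ->
  bigV A V (assemble (qpart x) (Zpart x *m g)) = bigV A V x.
Proof.
move=> go gv; rewrite /bigV.
have s2 : slow 0 (fun y => sqnorm (A y)) by apply: slow_sqnorm => i; exact: slow0 (slow_A _).
by rewrite (average_right x s2 go gv) (average_right x (slow0 tV) go gv).
Qed.

Lemma bigA_right (g : 'M[R]_(d + d)) (x : E) :
  g^T *m g = 1%:M -> preserves_volume g ->
  bigA A (assemble (qpart x) (Zpart x *m g)) =
  assemble (qpart (bigA A x)) (Zpart (bigA A x) *m g).
Proof.
move=> go gv; set y := assemble _ _.
have Ay : average_A A y = average_A A x.
  apply/matrixP => i j; rewrite [LHS]mxE [RHS]mxE.
  exact: average_right x (slow0 (slow_A i)) go gv.
have Jy : average_JA A y = average_JA A x.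
  apply/matrixP => i j; rewrite [LHS]mxE [RHS]mxE.
  exact: average_right x (slow0 (slow_JA i j)) go gv.
rewrite (bigA_assemble y) Ay Jy (bigA_assemble x).
by rewrite qpart_assemble !Zpart_assemble mulmxA.
Qed.

Lemma sample_point_left (U : 'M[R]_d) (x : E) t :
  sample_point (assemble (U *m qpart x) (U *m Zpart x)) t = U *m sample_point x t.
Proof. by rewrite /sample_point qpart_assemble Zpart_assemble mulmxDr mulmxA. Qed.

Lemma average_left f (U : 'M[R]_d) (x : E) :
  average f (assemble (U *m qpart x) (U *m Zpart x)) = average (fun y => f (U *m y)) x.
Proof.
by rewrite !averageE; congr (_ * _); apply: eq_Rintegral => t _; rewrite sample_point_left.
Qed.

(** Both sides are derivatives of A along the curve U (y + r e_k). *)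
Lemma jacobi_equivariant (U : 'M[R]_d) y : (forall z, A (U *m z) = U *m A z) ->
  jacobi A (U *m y) *m U = U *m jacobi A y.
Proof.
move=> UA; apply/matrixP => i k.
have dA z j : differentiable (component A j) z by exact: tame_differentiable (tA j) z.
pose c (r : R) := y + r *: (delta_mx k 0 : 'cV[R]_d).
have dc : is_derive (0 : R) (1 : R) c (delta_mx k 0) by exact: is_derive_line.
have c0 : c 0 = y by rewrite /c scale0r addr0.
have h1 : is_derive (0 : R) (1 : R) (A \o (fun r => U *m c r))
    (jacobi A (U *m c 0) *m (U *m delta_mx k 0)).
  by apply: chain_rule => //; exact: (is_derive_linear (mulmx U) dc).
have h2 : is_derive (0 : R) (1 : R) (A \o (fun r => U *m c r))
    (U *m (jacobi A (c 0) *m delta_mx k 0)).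
  rewrite (_ : _ \o _ = (fun r => U *m (A (c r)))); last by apply/funext => r /=.
  by apply: (is_derive_linear (mulmx U)); apply: chain_rule.
have := is_derive_unique h1 h2; rewrite c0 !mulmxA -!colE.
by move=> /(congr1 (fun X : 'cV[R]_d => X i 0)); rewrite !mxE.
Qed.

Lemma bigV_left (U : 'M[R]_d) (x : E) : U^T *m U = 1%:M ->
  (forall z, A (U *m z) = U *m A z) -> (forall z, V (U *m z) = V z) ->
  bigV A V (assemble (U *m qpart x) (U *m Zpart x)) = bigV A V x.
Proof.
move=> Uo UA UV; rewrite /bigV !average_left; congr (_ * _ + _); congr (average _ x).
  by apply/funext => z; rewrite UA /sqnorm -dot_trmx mulmxA Uo mul1mx.
by apply/funext => z.
Qed.

Lemma bigA_left (U : 'M[R]_d) (x : E) : U^T *m U = 1%:M ->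
  (forall z, A (U *m z) = U *m A z) ->
  bigA A (assemble (U *m qpart x) (U *m Zpart x)) =
  assemble (U *m qpart (bigA A x)) (U *m Zpart (bigA A x)).
Proof.
move=> Uo UA; have Uo' : U *m U^T = 1%:M by exact: mulmx1C.
rewrite !bigA_assemble !qpart_assemble !Zpart_assemble.
congr assemble.
  apply/matrixP => i j; rewrite ord1 !mxE average_left.
  have -> : (fun y => component A i (U *m y)) = (fun y => \sum_j U i j * component A j y).
    by apply/funext => y; rewrite /component UA mxE.
  rewrite average_lincomb => [|k]; last exact: slow0 (slow_A _).
  by apply: eq_bigr => k _; rewrite mxE.
suff -> : average_JA A (assemble (U *m qpart x) (U *m Zpart x)) =
    U *m average_JA A x *m U^T.
  by rewrite -!mulmxA [U^T *m (_ *m _)]mulmxA Uo mul1mx.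
apply/matrixP => i k; rewrite !mxE average_left.
have JU y : jacobi A (U *m y) = U *m jacobi A y *m U^T.
  by rewrite -jacobi_equivariant// -mulmxA Uo' mulmx1.
have -> : (fun y => jacobi A (U *m y) i k) =
    (fun y => \sum_l U k l * (\sum_j U i j * jacobi A y j l)).
  apply/funext => y; rewrite JU mxE; apply: eq_bigr => l _.
  by rewrite mulrC !mxE.
rewrite average_lincomb => [|l]; last first.
  by apply: slow_lincomb => j; exact: slow0 (slow_JA _ _).
apply: eq_bigr => l _; rewrite average_lincomb => [|j]; last exact: slow0 (slow_JA _ _).
by rewrite mulrC !mxE; congr (_ * _); apply: eq_bigr => j _; rewrite mxE.
Qed.

End AveragedSymmetry.

Section Translation.
Variables (R : realType) (d : nat).
Variables (A : 'cV[R]_d -> 'cV[R]_d) (V : 'cV[R]_d -> R).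

Definition ones : 'cV[R]_(bigdim d) := assemble (const_mx 1) 0.

Lemma sample_point_ones (x : 'cV[R]_(bigdim d)) r t :
  sample_point (x + r *: ones) t = sample_point x t + const_mx r.
Proof.
rewrite sample_pointD sample_pointZ; congr (_ + _).
rewrite /sample_point qpart_assemble Zpart_assemble mul0mx addr0.
by apply/matrixP => i j; rewrite !mxE mulr1.
Qed.

Lemma average_ones (f : 'cV[R]_d -> R) x r : (forall z, f (z + const_mx r) = f z) ->
  average f (x + r *: ones) = average f x.
Proof.
move=> fr; rewrite (averageE f (x + r *: ones)) [in RHS]averageE.
have -> // : (fun t => f (sample_point (x + r *: ones) t) * gauss t) =
          (fun t => f (sample_point x t) * gauss t).
by apply/funext => t; rewrite sample_point_ones fr.
Qed.

Hypothesis sym : translation_symmetric A V.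

Lemma bigV_ones x r : bigV A V (x + r *: ones) = bigV A V x.
Proof.
have s2 z : sqnorm (A (z + const_mx r)) = sqnorm (A z) by rewrite (sym z r).1.
have sV z : V (z + const_mx r) = V z by exact: (sym z r).2.
by rewrite /bigV (average_ones x s2) (average_ones x sV).
Qed.

Lemma bigA_ones x r : bigA A (x + r *: ones) = bigA A x.
Proof.
rewrite (bigA_assemble _ (x + _)) (bigA_assemble _ x).
have -> : Zpart (x + r *: ones) = Zpart x.
  by rewrite ZpartD ZpartZ Zpart_assemble scaler0 addr0.
have sA i z : component A i (z + const_mx r) = component A i z.
  by rewrite /component (sym z r).1.
have -> : average_A A (x + r *: ones) = average_A A x.
  apply/matrixP => i j; rewrite [LHS]mxE [RHS]mxE.
  exact: (@average_ones (component A i) x r (sA i)).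
have -> // : average_JA A (x + r *: ones) = average_JA A x.
apply/matrixP => i j; rewrite [LHS]mxE [RHS]mxE.
apply: (@average_ones (fun y => jacobi A y i j) x r) => z; rewrite mxE [RHS]mxE.
exact: (@pderiv_periodic _ _ (component A i) (const_mx r) z j (sA i)).
Qed.

End Translation.

(** * The conserved momentum maps *)

Section Generators.
Variables (R : realType) (d : nat).
Local Notation E := ('cV[R]_(bigdim d)).

Definition right_gen (K : 'M[R]_(d + d)) (x : E) : E := assemble 0 (Zpart x *m K).

Lemma right_gen_is_linear K : linear (right_gen K).
Proof.
move=> a x y; rewrite /right_gen assembleZ assembleD scaler0 addr0.
by rewrite ZpartD ZpartZ mulmxDl -scalemxAl.
Qed.

HB.instance Definition _ K :=
  GRing.isLinear.Build R E E *:%R (right_gen K) (right_gen_is_linear K).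

Definition left_gen (K : 'M[R]_d) (x : E) : E := assemble (K *m qpart x) (K *m Zpart x).

Lemma left_gen_is_linear K : linear (left_gen K).
Proof.
move=> a x y; rewrite /left_gen assembleZ assembleD.
by rewrite qpartD qpartZ ZpartD ZpartZ !mulmxDr -!scalemxAr.
Qed.

HB.instance Definition _ K :=
  GRing.isLinear.Build R E E *:%R (left_gen K) (left_gen_is_linear K).

Lemma rotor_right K (x : E) r :
  rotor (right_gen K) x r = assemble (qpart x) (Zpart x *m rotation K r).
Proof.
rewrite /rotor /right_gen -{1}(assembleK x) !assembleZ !assembleD Zpart_assemble.
by rewrite !scaler0 !addr0 /rotation !mulmxDr mulmx1 -!scalemxAr mulmxA.
Qed.

Lemma rotor_left K (x : E) r :
  rotor (left_gen K) x r =
  assemble (rotation K r *m qpart x) (rotation K r *m Zpart x).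
Proof.
rewrite /rotor /left_gen -{1}(assembleK x) !assembleZ !assembleD.
rewrite qpart_assemble Zpart_assemble /rotation !mulmxDl !mul1mx.
by rewrite -!scalemxAl !mulmxA.
Qed.

(** For K = [plane_gen i j] this is an entry of Z^T W - W^T Z. *)
Lemma dot_right_gen K (x y : E) : dot (right_gen K x) y =
  \tr (K^T *m ((Zpart x)^T *m Zpart y)).
Proof.
by rewrite -{1}(assembleK y) dot_assemble dot0l add0r trmx_mul mulmxA.
Qed.

(** For K = [plane_gen i j] this is an entry of the angular momentum. *)
Lemma dot_left_gen K (x y : E) : dot (left_gen K x) y =
  \tr (K^T *m (qpart y *m (qpart x)^T + Zpart y *m (Zpart x)^T)).
Proof.
rewrite -{1}(assembleK y) dot_assemble mulmxDr linearD /=; congr (_ + _).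
  rewrite mulmxA mxtrace_mulC /mxtrace big_ord1 mulmxA -trmx_mul.
  by [].
by rewrite trmx_mul mulmxA [RHS]mxtrace_mulC !mulmxA.
Qed.

Lemma mxtrace_skew n (K B : 'M[R]_n) : K^T = - K ->
  \tr (K^T *m B) = - \tr (K^T *m B^T).
Proof.
move=> KT; rewrite -[in RHS]mxtrace_tr trmx_mul !trmxK [in RHS]mxtrace_mulC KT.
by rewrite mulNmx linearN.
Qed.

Lemma skew_right_gen K (x y : E) : K^T = - K ->
  dot (right_gen K x) y = - dot x (right_gen K y).
Proof.
move=> KT; rewrite [dot x _]dotC !dot_right_gen mxtrace_skew//.
by rewrite trmx_mul trmxK.
Qed.

Lemma skew_left_gen K (x y : E) : K^T = - K ->
  dot (left_gen K x) y = - dot x (left_gen K y).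
Proof.
move=> KT; rewrite [dot x _]dotC !dot_left_gen mxtrace_skew//.
by rewrite linearD /= !trmx_mul !trmxK.
Qed.

Definition antisymm n (B : 'M[R]_n) := B - B^T.

Lemma antisymmZ n (a : R) (B : 'M[R]_n) : antisymm (a *: B) = a *: antisymm B.
Proof. by apply/matrixP => i j; rewrite !mxE mulrBr. Qed.

Lemma antisymmD n (B C : 'M[R]_n) : antisymm (B + C) = antisymm B + antisymm C.
Proof. by apply/matrixP => i j; rewrite !mxE opprD addrACA. Qed.

(** The entry (i, j) is the momentum map of the rotation in the plane of the
    coordinates i and j, which exists for i != j only. *)
Lemma eq_antisymm n (B C : 'M[R]_n) :
  (forall i j, i != j -> B i j - B j i = C i j - C j i) -> antisymm B = antisymm C.
Proof.
move=> BC; apply/matrixP => i j; rewrite !mxE.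
by have [->|/BC//] := eqVneq i j; rewrite !subrr.
Qed.

End Generators.

Section Conservation.
Variables (R : realType) (d : nat).
Variables (A : 'cV[R]_d -> 'cV[R]_d) (V : 'cV[R]_d -> R).
Hypothesis tA : forall i, tame (@pgrowth R d) 3 (component A i).
Hypothesis tV : tame (@pgrowth R d) 2 V.
Variables (scheme : seq (subsystem * R)) (s : nat) (L : 'M[R]_s) (b : 'cV[R]_s).
Hypothesis explicitL : explicit_tableau L.
Hypothesis b_neq0 : forall i, b i 0 != 0.
Local Notation step :=
  (compose_substeps (numeric_substep A V L (conjugate_tableau L b) b) scheme).

Lemma linear_noether (M : {linear 'cV[R]_(bigdim d) -> 'cV[R]_(bigdim d)}) tau (z z' : phase R d) :
  (forall x y, dot (M x) y = - dot x (M y)) ->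
  (forall x, dot (M x) (grad (bigV A V) x) = 0) ->
  (forall x, jacobi (bigA A) x *m M x = M (bigA A x)) ->
  step tau z z' -> dot (M z'.1) z'.2 = dot (M z.1) z.2.
Proof.
move=> skewM invV invA zz'.
have invV0 x : dot (M x + 0) (grad (bigV A V) x) = 0 by rewrite addr0.
have invA0 x : jacobi (bigA A) x *m (M x + 0) = M (bigA A x) by rewrite addr0.
have := compose_substeps_conserves skewM invV0 invA0 explicitL b_neq0 zz'.
by rewrite /noether !addr0.
Qed.

Lemma right_moment_conserved tau (z z' : phase R d) : step tau z z' ->
  antisymm ((Zpart z'.1)^T *m Zpart z'.2) = antisymm ((Zpart z.1)^T *m Zpart z.2).
Proof.
move=> zz'; apply: eq_antisymm => i j ij; rewrite -!tr_plane_gen -!dot_right_gen.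
have Ko r := @plane_rotation_orthogonal R _ i j r ij.
have Kv r := @preserves_volume_rotation R _ i j r ij.
apply: (linear_noether (M := right_gen (plane_gen i j)) _ _ _ zz').
- by move=> x y; apply: skew_right_gen; exact: plane_genT.
- move=> x; apply: rotor_invariant; first exact: differentiable_bigV.
  by move=> r; rewrite rotor_right bigV_right.
- move=> x; apply: rotor_equivariant => [k|r]; first exact: differentiable_bigA.
  by rewrite !rotor_right bigA_right.
Qed.

Lemma left_moment_conserved : rotation_symmetric A V ->
  forall tau (z z' : phase R d), step tau z z' ->
  antisymm (qpart z'.2 *m (qpart z'.1)^T + Zpart z'.2 *m (Zpart z'.1)^T) =
  antisymm (qpart z.2 *m (qpart z.1)^T + Zpart z.2 *m (Zpart z.1)^T).
Proof.
move=> sym tau z z' zz'; apply: eq_antisymm => i j ij; rewrite -!tr_plane_gen -!dot_left_gen.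
have Uo r := @plane_rotation_orthogonal R d i j r ij.
have UA r y := (sym y _ (Uo r) (@det_rotation R d i j r ij)).1.
have UV r y := (sym y _ (Uo r) (@det_rotation R d i j r ij)).2.
apply: (linear_noether (M := left_gen (plane_gen i j)) _ _ _ zz').
- by move=> x y; apply: skew_left_gen; exact: plane_genT.
- move=> x; apply: rotor_invariant; first exact: differentiable_bigV.
  by move=> r; rewrite rotor_left bigV_left.
- move=> x; apply: rotor_equivariant => [k|r]; first exact: differentiable_bigA.
  by rewrite !rotor_left bigA_left.
Qed.

Lemma total_momentum_conserved : translation_symmetric A V ->
  forall tau (z z' : phase R d), step tau z z' ->
  \sum_j qpart z'.2 j 0 = \sum_j qpart z.2 j 0.
Proof.
move=> sym tau z z' zz'.
pose O : {linear 'cV[R]_(bigdim d) -> 'cV[R]_(bigdim d)} := \0.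
have skewO x y : dot (O x) y = - dot x (O y) by rewrite dot0l dot0r oppr0.
have invV x : dot (O x + @ones R d) (grad (bigV A V) x) = 0.
  rewrite add0r; apply: line_invariant; first exact: differentiable_bigV.
  by move=> r; exact: bigV_ones.
have invA x : jacobi (bigA A) x *m (O x + @ones R d) = O (bigA A x).
  rewrite add0r; apply: line_invariant_mx => [i|r]; first exact: differentiable_bigA.
  exact: bigA_ones.
have := compose_substeps_conserves skewO invV invA explicitL b_neq0 zz'.
have E (y p : 'cV[R]_(bigdim d)) : dot (O y + @ones R d) p = \sum_j qpart p j 0.
  rewrite add0r -{1}(assembleK p) dot_assemble trmx0 mul0mx linear0 addr0 dotE.
  by apply: eq_bigr => j _; rewrite mxE mul1r.
by rewrite /noether !E.
Qed.

End Conservation.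

(** * Wave packets *)

Section Packets.
Variables (R : realType) (d : nat) (eps : R).

Lemma coords_qpart (w : packet R d) : qpart (coords eps w).1 = pos w.
Proof. by rewrite /qpart col_mxKu. Qed.

Lemma coords_ppart (w : packet R d) : qpart (coords eps w).2 = mom w.
Proof. by rewrite /qpart col_mxKu. Qed.

Lemma coords_Zpart (w : packet R d) : Zpart (coords eps w).1 =
  Num.sqrt (eps / 2) *: row_mx (reM (widthQ w)) (imM (widthQ w)).
Proof.
rewrite scale_row_mx /Zpart /X1part /X2part !col_mxKd !col_mxKu.
by rewrite !unvecZ !vecK.
Qed.

Lemma coords_Wpart (w : packet R d) : Zpart (coords eps w).2 =
  Num.sqrt (eps / 2) *: row_mx (reM (widthP w)) (imM (widthP w)).
Proof.
rewrite scale_row_mx /Zpart /X1part /X2part !col_mxKd !col_mxKu.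
by rewrite !unvecZ !vecK.
Qed.

Lemma reM_adj (X Y : 'M[R[i]%C]_d) :
  reM (X *m adjM Y) = reM X *m (reM Y)^T + imM X *m (imM Y)^T.
Proof.
apply/matrixP => i j; rewrite !mxE -big_split /=.
rewrite (big_morph (@complex.Re R) (id1 := 0) (op1 := +%R)) //; last by case=> a b [].
apply: eq_bigr => k _; rewrite !mxE.
by case: (X i k) (Y j k) => [a1 a2] [b1 b2] /=; rewrite mulrN opprK.
Qed.

Lemma reMB (X Y : 'M[R[i]%C]_d) : reM (X - Y) = reM X - reM Y.
Proof. by apply/matrixP => i j; rewrite !mxE; case: (X i j) (Y i j) => [a1 a2] []. Qed.

(** Y has the block rows (Re Q, Im Q) and (Re P, Im P), and Omega exchanges them
    up to sign, so Y^T Omega Y is the antisymmetrized product of the two rows. *)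
Lemma symplecticityE (w : packet R d) : symplecticity w <->
  antisymm ((row_mx (reM (widthQ w)) (imM (widthQ w)))^T *m
         row_mx (reM (widthP w)) (imM (widthP w))) = Omega R d.
Proof.
rewrite /symplecticity /widthY block_mxEv -mulmxA /Omega mul_block_col.
rewrite !mul0mx add0r addr0 mul1mx mulNmx mul1mx tr_col_mx mul_row_col mulmxN.
by rewrite /antisymm trmx_mul trmxK.
Qed.

Lemma symplectic_coords (w : packet R d) : 0 < eps ->
  antisymm ((Zpart (coords eps w).1)^T *m Zpart (coords eps w).2) =
  (eps / 2) *: antisymm ((row_mx (reM (widthQ w)) (imM (widthQ w)))^T *m
         row_mx (reM (widthP w)) (imM (widthP w))).
Proof.
move=> e0; rewrite coords_Zpart coords_Wpart [(_ *: _)^T]linearZ /=.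
rewrite -scalemxAl -scalemxAr scalerA antisymmZ.
by rewrite -expr2 sqr_sqrtr// divr_ge0// ltW.
Qed.

Lemma angular_coords (w : packet R d) : 0 < eps ->
  angular_momentum eps w =
  antisymm (qpart (coords eps w).2 *m (qpart (coords eps w).1)^T +
        Zpart (coords eps w).2 *m (Zpart (coords eps w).1)^T).
Proof.
move=> e0; rewrite coords_Zpart coords_Wpart coords_qpart coords_ppart.
rewrite [(_ *: row_mx _ _)^T]linearZ /= -scalemxAl -scalemxAr scalerA.
rewrite -expr2 sqr_sqrtr ?divr_ge0 ?ltW//.
rewrite /angular_momentum reMB !reM_adj -!mul_row_col -!tr_row_mx.
by rewrite antisymmD antisymmZ /antisymm !trmx_mul !trmxK.
Qed.

End Packets.

Theorem corollary4p7 (R : realType) (d : nat) (eps : R) (heps : 0 < eps)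
    (A : 'cV[R]_d -> 'cV[R]_d) (V : 'cV[R]_d -> R)
    (smoothA : forall i, smooth (component A i))
    (smoothV : smooth V)
    (boundedV : bounded_pderivs_from 2 (fun x => V x + 1 / 2 * sqnorm (A x)))
    (boundedA : forall i, bounded_pderivs_from 1 (component A i))
    (nu : nat) (scheme : seq (subsystem * R))
    (scheme_order : splitting_order A V scheme nu)
    (s : nat) (L : 'M[R]_s) (b : 'cV[R]_s)
    (explicitL : explicit_tableau L)
    (orderL : rk_order L b nu)
    (b_neq0 : forall i, b i 0 != 0) :
  let step := integrator_step A V eps L b scheme in
  [/\ forall (tau : R) (w w' : packet R d),
        step tau w w' -> symplecticity w -> symplecticity w',
      translation_symmetric A V ->
        forall (tau : R) (w w' : packet R d),
          step tau w w' -> linear_momentum w' = linear_momentum w &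
      rotation_symmetric A V ->
        forall (tau : R) (w w' : packet R d),
          step tau w w' -> angular_momentum eps w' = angular_momentum eps w].
Proof.
move=> step.
have [tA _] := slow_potentials 3 smoothA smoothV boundedV boundedA.
have [_ tV] := slow_potentials 2 smoothA smoothV boundedV boundedA.
have eps2 : eps / 2 != 0 by rewrite mulf_neq0 ?invr_eq0 ?pnatr_eq0// gt_eqF.
split.
- move=> tau w w' ww' /symplecticityE symw; apply/symplecticityE.
  apply: etrans symw; apply: (scalerI eps2).
  have cons := right_moment_conserved tA tV explicitL b_neq0 ww'.
  exact: etrans (etrans (esym (symplectic_coords w' heps)) cons) (symplectic_coords w heps).
- move=> sym tau w w' ww'.
  have := total_momentum_conserved tA tV explicitL b_neq0 sym ww'.
  by rewrite !coords_ppart.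
- move=> sym tau w w' ww'.
  have cons := left_moment_conserved tA tV explicitL b_neq0 sym ww'.
  exact: etrans (etrans (angular_coords w' heps) cons) (esym (angular_coords w heps)).
Qed.
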